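(* Let $\bar x\in\Gamma$ be a stationary point of (P) and let MSCQ hold at $\bar x$ with modulus $\sigma>0$. Suppose there is $\bar u\in K_\Gamma(\bar x,-\nabla f(\bar x))$ with $\nabla g(\bar x)\bar u\ne0$, let $\bar\lambda$ be the multiplier defined below, and assume that for some $\kappa>0$ $$\big\langle\big(\nabla^2 f(\bar x)+\nabla^2\langle\bar\lambda,g\rangle(\bar x)\big)u,u\big\rangle>\frac1\kappa$$ for all $u\in\mathcal S$ with $\langle\bar\lambda,\nabla g(\bar x)u\rangle=0$ and $\bar\lambda_0\big(\|\nabla g_r(\bar x)u\|^2-(\nabla g_0(\bar x)u)^2\big)=0$. Then $\bar x$ is a tilt-stable local minimizer of (P) with modulus $\kappa$, and $$\mathrm{tilt}(f+\delta_\Gamma,\bar x)\le\sup\Big\{\frac{1}{\langle(\nabla^2 f(\bar x)+\nabla^2\langle\bar\lambda,g\rangle(\bar x))u,u\rangle}\;\Big|\;u\in\mathcal S,\ \langle\bar\lambda,\nabla g(\bar x)u\rangle=0,\ \bar\lambda_0\big(\|\nabla g_r(\bar x)u\|^2-(\nabla g_0(\bar x)u)^2\big)=0\Big\}.$$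
   Context: Setting. Let $n,m\ge1$ and let $\mathcal Q:=\{(q_0,q_r)\in\mathbb R\times\mathbb R^m:\|q_r\|\le q_0\}$ be the second-order cone. For $q=(q_0,q_r)\in\mathbb R^{1+m}$ write $\hat q:=(-q_0,q_r)$, and let $\mathcal Q^*:=\{\hat q: q\in\mathcal Q\}=\{(q_0,q_r):\|q_r\|\le-q_0\}$. The normal cone to $\mathcal Q$ at $q\in\mathcal Q$ is $N_{\mathcal Q}(q)=\mathcal Q^*$ if $q=0$, $N_{\mathcal Q}(q)=\{0\}$ if $q\in\operatorname{int}\mathcal Q$, and $N_{\mathcal Q}(q)=\{\alpha\hat q:\alpha\ge0\}$ if $q\in\operatorname{bd}\mathcal Q\setminus\{0\}$. Problem (P) is: minimize $f(x)$ subject to $x\in\Gamma:=\{x\in\mathbb R^n: g(x)\in\mathcal Q\}$, where $f:\mathbb R^n\to\mathbb R$ and $g=(g_0,g_r):\mathbb R^n\to\mathbb R\times\mathbb R^m$ are $C^2$-smooth around a point $\bar x\in\Gamma$ with $g(\bar x)=0$. $\hat g(x):=(-g_0(x),g_r(x))$. $\nabla g(x)$ is the Jacobian, $\nabla g(x)^*$ its transpose, $\nabla^2 g(x)(u,v)\in\mathbb R^{1+m}$ is the vector with components $u^T\nabla^2 g_i(x)v$, and $\nabla^2\langle\lambda,g\rangle(x)=\sum_i\lambda_i\nabla^2 g_i(x)$. $\mathcal S$ is the unit sphere. Special multiplier: $\bar\lambda:=\dfrac{\|\nabla f(\bar x)\|}{\|\nabla g(\bar x)^*\nabla\hat g(\bar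 x)\bar u\|}\,\nabla\hat g(\bar x)\bar u$ (with $\bar\lambda:=0$ when $\nabla f(\bar x)=0$). MSCQ. The metric subregularity constraint qualification (MSCQ) holds at $\bar x$ with modulus $\sigma>0$ if there is a neighborhood $U$ of $\bar x$ with $\operatorname{dist}(x;\Gamma)\le\sigma\operatorname{dist}(g(x);\mathcal Q)$ for all $x\in U$. Cones. $T_\Gamma(x)$ is the Bouligand tangent cone $\{v:\exists t_k\downarrow0,\ v_k\to v,\ x+t_kv_k\in\Gamma\}$; the critical cone is $K_\Gamma(x,x^* ):=\{u\in T_\Gamma(x):\langle x^*,u\rangle=0\}$. Stationarity and tilt stability. $\bar x$ is a stationary point of (P) if $-\nabla f(\bar x)\in N_\Gamma(\bar x)$, where $N_\Gamma$ is the limiting (Mordukhovich) normal cone. Let $\varphi:=f+\delta_\Gamma$ ($\delta_\Gamma$ the indicator function of $\Gamma$). $\bar x$ is a tilt-stable local minimizer of (P) with modulus $\kappa>0$ if there is $\gamma>0$ such that $M_\gamma(v^* ):=\operatorname{argmin}\{\varphi(x)-\langle v^*,x\rangle:\|x-\bar x\|\le\gamma\}$ is single-valued and Lipschitz continuous with constant $\kappa$ on a neighborhood of $0$, with $M_\gamma(0)=\{\bar x\}$. The exact bound of tilt stability is $\mathrm{tilt}(\varphi,\bar x):=\inf_{\gamma>0}\operatorname{lip}M_\gamma(0)$, where $\operatorname{lip}M_\gamma(0)$ is the infimum of the Lipschitz constants of $M_\gamma$ on neighborhoods of $0$. *)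

(* Defs.v *)
From Stdlib Require Import Reals.
From mathcomp Require Import all_boot.
Set Implicit Arguments.
Unset Strict Implicit.
Open Scope R_scope.

Definition vec (n : nat) := 'I_n -> R.
Definition mat (n : nat) := 'I_n -> 'I_n -> R.

Definition dot {n} (x y : vec n) : R := \big[Rplus/0]_(i < n) (x i * y i).
Definition vnorm {n} (x : vec n) : R := sqrt (dot x x).
Definition vadd {n} (x y : vec n) : vec n := fun i => x i + y i.
Definition vsub {n} (x y : vec n) : vec n := fun i => x i - y i.
Definition vopp {n} (x : vec n) : vec n := fun i => - x i.
Definition vscale {n} (a : R) (x : vec n) : vec n := fun i => a * x i.
Definition vzero (n : nat) : vec n := fun _ => 0.
Definition quad {n} (A : mat n) (u : vec n) : R :=
  \big[Rplus/0]_(i < n) \big[Rplus/0]_(j < n) (u i * A i j * u j).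

Definition has_grad {n} (F : vec n -> R) (x G : vec n) : Prop :=
  forall eps, 0 < eps -> exists delta, 0 < delta /\
    forall h : vec n, vnorm h < delta ->
      Rabs (F (vadd x h) - F x - dot G h) <= eps * vnorm h.

Definition cont_at {n} (F : vec n -> R) (x : vec n) : Prop :=
  forall eps, 0 < eps -> exists delta, 0 < delta /\
    forall y, vnorm (vsub y x) < delta -> Rabs (F y - F x) < eps.

Definition C2_with {n} (F : vec n -> R) (DF : vec n -> vec n)
  (D2F : vec n -> mat n) (x0 : vec n) : Prop :=
  exists r, 0 < r /\ forall x, vnorm (vsub x x0) < r ->
    has_grad F x (DF x) /\
    (forall i, has_grad (fun y => DF y i) x (D2F x i)) /\
    (forall i j, cont_at (fun y => D2F y i j) x).

Definition in_Q {m} (q0 : R) (qr : vec m) : Prop := vnorm qr <= q0.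
Definition in_Gamma {n m} (g0 : vec n -> R) (gr : vec n -> vec m) (x : vec n) : Prop :=
  in_Q (g0 x) (gr x).

(* a is the infimum of E (E nonempty in all uses) *)
Definition is_inf (E : R -> Prop) (a : R) : Prop :=
  (forall t, E t -> a <= t) /\ (forall b, (forall t, E t -> b <= t) -> b <= a).

Definition MSCQ {n m} (g0 : vec n -> R) (gr : vec n -> vec m) (xbar : vec n)
  (sigma : R) : Prop :=
  0 < sigma /\ exists r, 0 < r /\ forall x, vnorm (vsub x xbar) < r ->
    forall d1 d2,
      is_inf (fun t => exists y, in_Gamma g0 gr y /\ t = vnorm (vsub x y)) d1 ->
      is_inf (fun t => exists q0 (qr : vec m), in_Q q0 qr /\
                 t = sqrt ((g0 x - q0) ^ 2 + (vnorm (vsub (gr x) qr)) ^ 2)) d2 ->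
      d1 <= sigma * d2.

Definition seq_cv {n} (s : nat -> vec n) (x : vec n) : Prop :=
  Un_cv (fun k => vnorm (vsub (s k) x)) 0.

Definition reg_normal {n} (C : vec n -> Prop) (x v : vec n) : Prop :=
  C x /\ forall eps, 0 < eps -> exists delta, 0 < delta /\
    forall y, C y -> vnorm (vsub y x) < delta ->
      dot v (vsub y x) <= eps * vnorm (vsub y x).

Definition lim_normal {n} (C : vec n -> Prop) (x v : vec n) : Prop :=
  C x /\ exists (xs vs : nat -> vec n),
    (forall k, reg_normal C (xs k) (vs k)) /\ seq_cv xs x /\ seq_cv vs v.

Definition tangent {n} (C : vec n -> Prop) (x v : vec n) : Prop :=
  exists (t : nat -> R) (vs : nat -> vec n),
    (forall k, 0 < t k) /\ Un_cv t 0 /\ seq_cv vs v /\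
    forall k, C (vadd x (vscale (t k) (vs k))).

Definition critical_cone {n} (C : vec n -> Prop) (x xs u : vec n) : Prop :=
  tangent C x u /\ dot xs u = 0.

Definition argminM {n} (f : vec n -> R) (C : vec n -> Prop) (xbar : vec n)
  (gamma : R) (v x : vec n) : Prop :=
  C x /\ vnorm (vsub x xbar) <= gamma /\
  forall y, C y -> vnorm (vsub y xbar) <= gamma -> f x - dot v x <= f y - dot v y.

Definition lip_single_on {n} (M : vec n -> vec n -> Prop) (delta L : R) : Prop :=
  (forall v, vnorm v < delta -> exists x, M v x /\ forall x', M v x' -> x' = x) /\
  (forall v1 v2 x1 x2, vnorm v1 < delta -> vnorm v2 < delta ->
     M v1 x1 -> M v2 x2 -> vnorm (vsub x1 x2) <= L * vnorm (vsub v1 v2)).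

Definition tilt_stable {n} (f : vec n -> R) (C : vec n -> Prop) (xbar : vec n)
  (kappa : R) : Prop :=
  0 < kappa /\ exists gamma, 0 < gamma /\
    (exists delta, 0 < delta /\ lip_single_on (argminM f C xbar gamma) delta kappa) /\
    (forall x, argminM f C xbar gamma (@vzero n) x <-> x = xbar).

(* tilt(f + delta_C, xbar) <= b, where tilt = inf_{gamma>0} lip M_gamma(0) and
   lip M_gamma(0) = inf of Lipschitz constants of M_gamma on neighborhoods of 0. *)
Definition tilt_le {n} (f : vec n -> R) (C : vec n -> Prop) (xbar : vec n)
  (b : R) : Prop :=
  forall eps, 0 < eps -> exists gamma L delta,
    0 < gamma /\ 0 <= L /\ L < b + eps /\ 0 < delta /\
    lip_single_on (argminM f C xbar gamma) delta L.

Definition jac_r {n m} (Dgr : 'I_m -> vec n) (u : vec n) : vec m :=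
  fun i => dot (Dgr i) u.
Definition gstar_ghat {n m} (Dg0 : vec n) (Dgr : 'I_m -> vec n) (u : vec n) : vec n :=
  fun j => - (dot Dg0 u) * Dg0 j + \big[Rplus/0]_(i < m) (dot (Dgr i) u * Dgr i j).
(* scalar factor ||grad f|| / ||nabla g^* nabla ghat u||; equals 0 when grad f = 0
   (since 0 / a = 0), matching the convention lambda := 0 in that case *)
Definition lam_coef {n m} (Df Dg0 : vec n) (Dgr : 'I_m -> vec n) (u : vec n) : R :=
  vnorm Df / vnorm (gstar_ghat Dg0 Dgr u).
Definition lam0 {n m} (Df Dg0 : vec n) (Dgr : 'I_m -> vec n) (u : vec n) : R :=
  lam_coef Df Dg0 Dgr u * (- dot Dg0 u).
Definition lamr {n m} (Df Dg0 : vec n) (Dgr : 'I_m -> vec n) (u : vec n) : vec m :=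
  fun i => lam_coef Df Dg0 Dgr u * dot (Dgr i) u.

(* Main.v *)
Require Import Defs.
From Stdlib Require Import Reals Lra FunctionalExtensionality ClassicalEpsilon.
From mathcomp Require Import all_boot Rstruct.
From Coquelicot Require Import Coquelicot.

(** Under MSCQ every regular normal [v] to [Gamma] at a point near [xbar] has a multiplier
    in the normal cone of [Q] of norm at most [2 sigma |v|].  Complementarity with the
    critical direction [ubar] makes the special multiplier the only bounded multiplier at
    [xbar], so the multipliers of nearby stationary points of the tilted problems converge
    to it.  A compactness argument then upgrades the second-order condition to the uniform
    growth [f y >= f x + <v, y - x> + |y - x|^2 / (2 kappa)] for all feasible [y] and all
    stationary pairs [(x, v)] near [(xbar, 0)]: if the growth fails along a sequence, then
    [- <lambda, g y>] is [O(|y - x|^2)], which forces the limit of [(y - x) / |y - x|] to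
    satisfy the two equations of the second-order condition.  Adding the growth
    inequalities at two tilted minimizers gives the Lipschitz constant [kappa]; every
    [k > b] is itself an admissible constant, whence the bound on the exact modulus. *)

Set Implicit Arguments.
Unset Strict Implicit.
Unset Printing Implicit Defensive.
Open Scope R_scope.

(** * Euclidean vectors *)

Ltac vext := apply: functional_extensionality => ?;
  rewrite /vadd /vsub /vscale /vopp /vzero; ring.

Lemma Rabs_sum_le n (F : 'I_n -> R) a : (forall i, Rabs (F i) <= a) ->
  Rabs (\big[Rplus/0]_(i < n) F i) <= INR n * a.
Proof.
elim: n F => [|n IHn] F Fa; first by rewrite big_ord0 Rabs_R0 /=; lra.
rewrite big_ord_recl S_INR; apply: Rle_trans (Rabs_triang _ _) _.
by have := Fa ord0; have := IHn _ (fun i => Fa (lift ord0 i)); lra.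
Qed.

Lemma dotC n (x y : vec n) : dot x y = dot y x.
Proof. by apply: eq_bigr => i _; ring. Qed.

Lemma dotDl n (x y z : vec n) : dot (vadd x y) z = dot x z + dot y z.
Proof. by rewrite /dot -big_split; apply: eq_bigr => i _; rewrite /vadd /=; ring. Qed.

Lemma dotZl n a (x y : vec n) : dot (vscale a x) y = a * dot x y.
Proof. by rewrite /dot big_distrr; apply: eq_bigr => i _; rewrite /vscale /=; ring. Qed.

Lemma dotNl n (x y : vec n) : dot (vopp x) y = - dot x y.
Proof. by rewrite (_ : vopp x = vscale (-1) x) ?dotZl; [ring|vext]. Qed.

Lemma dotBl n (x y z : vec n) : dot (vsub x y) z = dot x z - dot y z.
Proof. by rewrite (_ : vsub x y = vadd x (vopp y)) ?dotDl ?dotNl; [ring|vext]. Qed.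

Lemma dot0l n (x : vec n) : dot (@vzero n) x = 0.
Proof. by rewrite (_ : @vzero n = vscale 0 x) ?dotZl; [ring|vext]. Qed.

Lemma dotDr n (x y z : vec n) : dot z (vadd x y) = dot z x + dot z y.
Proof. by rewrite dotC dotDl !(dotC _ z). Qed.

Lemma dotZr n a (x y : vec n) : dot y (vscale a x) = a * dot y x.
Proof. by rewrite dotC dotZl dotC. Qed.

Lemma dotNr n (x y : vec n) : dot y (vopp x) = - dot y x.
Proof. by rewrite dotC dotNl dotC. Qed.

Lemma dotBr n (x y z : vec n) : dot z (vsub x y) = dot z x - dot z y.
Proof. by rewrite dotC dotBl !(dotC _ z). Qed.

Lemma dot0r n (x : vec n) : dot x (@vzero n) = 0.
Proof. by rewrite dotC dot0l. Qed.

Definition dotE := (dotDl, dotDr, dotBl, dotBr, dotZl, dotZr, dotNl, dotNr,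
  dot0l, dot0r).

Lemma dot_ge0 n (x : vec n) : 0 <= dot x x.
Proof. by apply: (big_ind (fun u => 0 <= u)) => [|u v ? ?|i _]; [lra|lra|nra]. Qed.

Lemma vnorm_ge0 n (x : vec n) : 0 <= vnorm x.
Proof. exact: sqrt_pos. Qed.

Lemma vnorm_sqr n (x : vec n) : vnorm x ^ 2 = dot x x.
Proof. exact/pow2_sqrt/dot_ge0. Qed.

Lemma vnorm_le n (x : vec n) a : 0 <= a -> dot x x <= a ^ 2 -> vnorm x <= a.
Proof. by move=> a_ge0; rewrite -vnorm_sqr; have := vnorm_ge0 x; nra. Qed.

Lemma coord_le_vnorm n (x : vec n) i : Rabs (x i) <= vnorm x.
Proof.
rewrite -(sqrt_Rsqr_abs (x i)); apply: sqrt_le_1_alt.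
rewrite /dot (bigD1 i) //= /Rsqr -[X in X <= _]Rplus_0_r.
apply: Rplus_le_compat_l.
by apply: (big_ind (fun u => 0 <= u)) => [|u v ? ?|j _]; [lra|lra|nra].
Qed.

Lemma vnorm_le_coord n (x : vec n) e : 0 <= e ->
  (forall i, Rabs (x i) <= e) -> vnorm x <= INR n * e.
Proof.
move=> e_ge0 xe; have x_ge0 := vnorm_ge0 x.
have ne_ge0 : 0 <= INR n * e by apply: Rmult_le_pos => //; apply: pos_INR.
suff : vnorm x ^ 2 <= INR n * (vnorm x * e) by nra.
rewrite vnorm_sqr; apply: Rle_trans (Rle_abs _) _; apply: Rabs_sum_le => i.
rewrite Rabs_mult; apply: Rmult_le_compat (xe i); try exact: Rabs_pos.
exact: coord_le_vnorm.
Qed.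

Lemma vnorm0 n : vnorm (@vzero n) = 0.
Proof. by rewrite /vnorm dot0l sqrt_0. Qed.

Lemma vnorm_eq0 n (x : vec n) : vnorm x = 0 -> x = @vzero n.
Proof.
move=> x0; apply: functional_extensionality => i; apply: Rabs_eq_0.
by have := coord_le_vnorm x i; have := Rabs_pos (x i); lra.
Qed.

Lemma vnorm_gt0 n (x : vec n) : x <> @vzero n -> 0 < vnorm x.
Proof. by move=> x_neq0; case: (vnorm_ge0 x) => // /esym/vnorm_eq0. Qed.

Lemma vnormZ n a (x : vec n) : vnorm (vscale a x) = Rabs a * vnorm x.
Proof.
rewrite /vnorm !dotE -Rmult_assoc sqrt_mult; [|nra|exact: dot_ge0].
by rewrite sqrt_Rsqr_abs.
Qed.

Lemma vnormZ_ge0 n a (x : vec n) : 0 <= a -> vnorm (vscale a x) = a * vnorm x.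
Proof. by move=> a_ge0; rewrite vnormZ Rabs_pos_eq. Qed.

Lemma vnormN n (x : vec n) : vnorm (vopp x) = vnorm x.
Proof. by rewrite /vnorm !dotE Ropp_involutive. Qed.

Lemma dot_le_vnorm n (x y : vec n) : dot x y <= vnorm x * vnorm y.
Proof.
have [x_gt0|/esym/vnorm_eq0 ->] := vnorm_ge0 x; last by rewrite dot0l vnorm0; lra.
have [y_gt0|/esym/vnorm_eq0 ->] := vnorm_ge0 y; last by rewrite dot0r vnorm0; lra.
have xy_gt0 := Rmult_lt_0_compat _ _ x_gt0 y_gt0.
have := dot_ge0 (vsub (vscale (vnorm y) x) (vscale (vnorm x) y)).
rewrite !dotE (dotC y x) -!vnorm_sqr => discr.
have : 0 <= 2 * (vnorm x * vnorm y) * (vnorm x * vnorm y - dot x y) by nra.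
by move=> ?; apply: Rnot_lt_le => ?; nra.
Qed.

Lemma Rabs_dot_le n (x y : vec n) : Rabs (dot x y) <= vnorm x * vnorm y.
Proof.
apply: Rabs_le; split; last exact: dot_le_vnorm.
by have := dot_le_vnorm (vopp x) y; rewrite dotNl vnormN; lra.
Qed.

Lemma vnormD n (x y : vec n) : vnorm (vadd x y) <= vnorm x + vnorm y.
Proof.
apply: vnorm_le; first by have := vnorm_ge0 x; have := vnorm_ge0 y; lra.
by rewrite !dotE (dotC y x) -!vnorm_sqr; have := dot_le_vnorm x y; lra.
Qed.

Lemma vdistC n (x y : vec n) : vnorm (vsub x y) = vnorm (vsub y x).
Proof. by rewrite /vnorm !dotE; congr sqrt; ring. Qed.

Lemma vdist0 n (x : vec n) : vnorm (vsub x x) = 0.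
Proof. by rewrite (_ : vsub x x = @vzero n) ?vnorm0 //; vext. Qed.

Lemma vdist_triangle n (x y z : vec n) :
  vnorm (vsub x z) <= vnorm (vsub x y) + vnorm (vsub y z).
Proof.
by rewrite (_ : vsub x z = vadd (vsub x y) (vsub y z)); [exact: vnormD|vext].
Qed.

Lemma vsub0 n (x : vec n) : vsub x (@vzero n) = x.
Proof. by vext. Qed.

Lemma vsub_eq0 n (x y : vec n) : vsub x y = @vzero n -> x = y.
Proof.
move=> xy0; apply: functional_extensionality => i.
by have := congr1 (fun z => z i) xy0; rewrite /vsub /vzero; lra.
Qed.

Lemma vaddBK n (x y : vec n) : vadd x (vsub y x) = y.
Proof. by vext. Qed.

Lemma vaddK n (x h : vec n) : vsub (vadd x h) x = h.
Proof. by vext. Qed.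

Lemma dot_inj n (x y : vec n) : (forall h, dot x h = dot y h) -> x = y.
Proof.
by move=> xy; apply/vsub_eq0/vnorm_eq0; rewrite /vnorm dotBl xy Rminus_diag sqrt_0.
Qed.

Definition adj {n p} (A : 'I_p -> vec n) (l : vec p) : vec n :=
  fun j => \big[Rplus/0]_(i < p) (l i * A i j).

Lemma dot_adj n p (A : 'I_p -> vec n) l h : dot (adj A l) h = dot l (jac_r A h).
Proof.
rewrite /dot /adj /jac_r /dot.
under eq_bigr => j _ do rewrite Rmult_comm big_distrr.
rewrite exchange_big; apply: eq_bigr => i _ /=.
by rewrite big_distrr; apply: eq_bigr => j _ /=; ring.
Qed.

Lemma adjD n p (A : 'I_p -> vec n) l l' : adj A (vadd l l') = vadd (adj A l) (adj A l').
Proof. by apply: dot_inj => h; rewrite dotDl !dot_adj dotDl. Qed.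

Lemma adjZ n p (A : 'I_p -> vec n) a l : adj A (vscale a l) = vscale a (adj A l).
Proof. by apply: dot_inj => h; rewrite dotZl !dot_adj dotZl. Qed.

Lemma jacZ n p (A : 'I_p -> vec n) a h : jac_r A (vscale a h) = vscale a (jac_r A h).
Proof. by apply: functional_extensionality => i; rewrite /jac_r dotZr. Qed.

Lemma quadZ n (A : mat n) a d : quad A (vscale a d) = a ^ 2 * quad A d.
Proof.
rewrite /quad big_distrr; apply: eq_bigr => i _ /=.
by rewrite big_distrr; apply: eq_bigr => j _; rewrite /vscale /=; ring.
Qed.

Lemma quadD n (A B : mat n) d :
  quad (fun i j => A i j + B i j) d = quad A d + quad B d.
Proof.
rewrite /quad -big_split; apply: eq_bigr => i _ /=.
by rewrite -big_split; apply: eq_bigr => j _ /=; ring.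
Qed.

Lemma quad_scale n a (A : mat n) d : quad (fun i j => a * A i j) d = a * quad A d.
Proof.
rewrite /quad big_distrr; apply: eq_bigr => i _ /=.
by rewrite big_distrr; apply: eq_bigr => j _ /=; ring.
Qed.

Lemma quad_sum n p (A : 'I_p -> mat n) d :
  quad (fun i j => \big[Rplus/0]_(k < p) A k i j) d = \big[Rplus/0]_(k < p) quad (A k) d.
Proof.
rewrite /quad [RHS]exchange_big; apply: eq_bigr => i _ /=.
rewrite [RHS]exchange_big; apply: eq_bigr => j _ /=.
by rewrite big_distrr big_distrl.
Qed.

Lemma dot_quad n (A : mat n) d : dot (jac_r A d) d = quad A d.
Proof.
apply: eq_bigr => i _; rewrite Rmult_comm /jac_r /dot big_distrr.
by apply: eq_bigr => j _ /=; ring.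
Qed.

Lemma Rabs_quad_le n (A : mat n) e d : 0 <= e -> (forall i j, Rabs (A i j) <= e) ->
  Rabs (quad A d) <= INR n ^ 2 * e * vnorm d ^ 2.
Proof.
move=> e_ge0 Ae.
rewrite (_ : _ * _ = INR n * (INR n * (vnorm d * e * vnorm d))); last ring.
do 2! apply: Rabs_sum_le => ?.
rewrite !Rabs_mult.
by do 2! [apply: Rmult_le_compat => //; try exact: coord_le_vnorm;
  do ?apply: Rmult_le_pos; try exact: Rabs_pos].
Qed.

(** * Limits of sequences *)

Lemma lim_le u v (a b : R) : (forall k, u k <= v k) ->
  is_lim_seq u a -> is_lim_seq v b -> a <= b.
Proof. exact: is_lim_seq_le. Qed.

Lemma lim_unique u (a b : R) : is_lim_seq u a -> is_lim_seq u b -> a = b.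
Proof.
move=> ua ub; have le_u k : u k <= u k := Rle_refl _.
by apply: Rle_antisym; [exact: lim_le le_u ua ub|exact: lim_le le_u ub ua].
Qed.

Lemma lim_near u (l : R) eps : is_lim_seq u l -> 0 < eps ->
  eventually (fun k => Rabs (u k - l) < eps).
Proof. by move=> /is_lim_seq_spec ul eps_gt0; apply: (ul (mkposreal _ eps_gt0)). Qed.

Lemma lim_of_dist u v (l : R) : is_lim_seq v 0 ->
  (forall k, Rabs (u k - l) <= v k) -> is_lim_seq u l.
Proof.
move=> v0 uv; apply: (is_lim_seq_ext (fun k => (u k - l) + l)) => [k|]; first ring.
rewrite -[X in Finite X]Rplus_0_l; apply: is_lim_seq_plus'; last exact: is_lim_seq_const.
apply/is_lim_seq_abs_0; apply: is_lim_seq_le_le (is_lim_seq_const 0) v0 => k.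
by split=> //; apply: Rabs_pos.
Qed.

Lemma lim_bounded u (l : R) : is_lim_seq u l -> exists M, forall k, Rabs (u k) <= M.
Proof.
by move=> /is_lim_seq_Reals ul; have [M [_ uM]] := maj_by_pos _ (exist _ _ ul); exists M.
Qed.

Definition inv_succ (k : nat) : R := / (INR k + 1).

Lemma inv_succ_gt0 k : 0 < inv_succ k.
Proof. by apply: Rinv_0_lt_compat; have := pos_INR k; lra. Qed.

Lemma lim_inv_succ : is_lim_seq inv_succ 0.
Proof.
apply: (is_lim_seq_ext (fun k => / INR k.+1)) => [k|]; first by rewrite S_INR.
apply/(is_lim_seq_incr_1 (fun k => / INR k)).
by apply: (is_lim_seq_inv _ p_infty) => //; apply: is_lim_seq_INR.
Qed.

Definition extraction (phi : nat -> nat) : Prop := filterlim phi eventually eventually.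

Lemma extraction_comp phi psi : extraction phi -> extraction psi ->
  extraction (fun k => phi (psi k)).
Proof. by move=> ephi epsi; apply: filterlim_comp epsi ephi. Qed.

Lemma extraction_shift N : extraction (fun k => (k + N)%coq_nat).
Proof.
move=> P [M HM]; exists M => k le_Mk; apply: HM.
exact: Nat.le_trans le_Mk (Nat.le_add_r _ _).
Qed.

Definition vlim {n} (s : nat -> vec n) (x : vec n) : Prop :=
  forall i, is_lim_seq (fun k => s k i) (x i).

Lemma vlim_subseq n (s : nat -> vec n) x phi : extraction phi -> vlim s x ->
  vlim (fun k => s (phi k)) x.
Proof. by move=> ephi sx i; apply: is_lim_seq_subseq ephi (sx i). Qed.

Lemma vlim_unique n (s : nat -> vec n) x y : vlim s x -> vlim s y -> x = y.
Proof.
by move=> sx sy; apply: functional_extensionality => i; apply: lim_unique (sx i) (sy i).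
Qed.

Lemma vlim_const n (x : vec n) : vlim (fun=> x) x.
Proof. by move=> i; apply: is_lim_seq_const. Qed.
Arguments vlim_const {n} x.

Lemma vlimD n (s t : nat -> vec n) x y : vlim s x -> vlim t y ->
  vlim (fun k => vadd (s k) (t k)) (vadd x y).
Proof. by move=> sx ty i; apply: (is_lim_seq_plus' _ _ _ _ (sx i) (ty i)). Qed.

Lemma vlimB n (s t : nat -> vec n) x y : vlim s x -> vlim t y ->
  vlim (fun k => vsub (s k) (t k)) (vsub x y).
Proof. by move=> sx ty i; apply: (is_lim_seq_minus' _ _ _ _ (sx i) (ty i)). Qed.

Lemma vlimZ n (u : nat -> R) (a : R) (s : nat -> vec n) x : is_lim_seq u a -> vlim s x ->
  vlim (fun k => vscale (u k) (s k)) (vscale a x).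
Proof. by move=> ua sx i; apply: (is_lim_seq_mult' _ _ _ _ ua (sx i)). Qed.

Lemma lim_sum n (u : nat -> 'I_n -> R) (l : 'I_n -> R) :
  (forall i, is_lim_seq (fun k => u k i) (l i)) ->
  is_lim_seq (fun k => \big[Rplus/0]_(i < n) u k i) (\big[Rplus/0]_(i < n) l i).
Proof.
elim: n u l => [|n IHn] u l ul.
  rewrite big_ord0; apply: is_lim_seq_ext (is_lim_seq_const 0) => k.
  by rewrite big_ord0.
rewrite big_ord_recl.
apply: (is_lim_seq_ext
    (fun k => u k ord0 + \big[Rplus/0]_(i < n) u k (lift ord0 i))) => [k|].
  by rewrite big_ord_recl.
by apply: is_lim_seq_plus' => //; apply: IHn => i.
Qed.

Lemma lim_dot n (s t : nat -> vec n) x y : vlim s x -> vlim t y ->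
  is_lim_seq (fun k => dot (s k) (t k)) (dot x y).
Proof. by move=> sx ty; apply: lim_sum => i; apply: is_lim_seq_mult'. Qed.

Lemma lim_quad n (A : mat n) (s : nat -> vec n) x : vlim s x ->
  is_lim_seq (fun k => quad A (s k)) (quad A x).
Proof.
move=> sx; do 2! [apply: lim_sum => ?].
by do 2! [apply: is_lim_seq_mult' => //]; apply: is_lim_seq_const.
Qed.

Lemma vlim_adj n p (A : nat -> 'I_p -> vec n) A0 (l : nat -> vec p) l0 :
  (forall i, vlim (fun k => A k i) (A0 i)) -> vlim l l0 ->
  vlim (fun k => adj (A k) (l k)) (adj A0 l0).
Proof.
by move=> lim_A lim_l j; apply: lim_sum => i; apply: is_lim_seq_mult' => //; apply: lim_A.
Qed.

Lemma lim_vnorm n (s : nat -> vec n) x : vlim s x ->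
  is_lim_seq (fun k => vnorm (s k)) (vnorm x).
Proof.
move=> sx; apply: (is_lim_seq_continuous sqrt); last exact: lim_dot.
exact/continuity_pt_sqrt/dot_ge0.
Qed.

Lemma vlim_dist n (s : nat -> vec n) x : vlim s x ->
  is_lim_seq (fun k => vnorm (vsub (s k) x)) 0.
Proof. by move=> sx; rewrite -(vdist0 x); apply/lim_vnorm/vlimB/vlim_const. Qed.

Lemma vlim_of_dist n (s : nat -> vec n) x u : is_lim_seq u 0 ->
  (forall k, vnorm (vsub (s k) x) <= u k) -> vlim s x.
Proof.
move=> u0 su i; apply: lim_of_dist u0 _ => k.
exact: Rle_trans (coord_le_vnorm (vsub (s k) x) i) (su k).
Qed.

Lemma seq_cv_vlim n (s : nat -> vec n) x : seq_cv s x -> vlim s x.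
Proof. by move=> /is_lim_seq_Reals sx; apply: vlim_of_dist sx _ => k; lra. Qed.

Lemma vlim_bounded n (s : nat -> vec n) x : vlim s x ->
  exists M, forall k, vnorm (s k) <= M.
Proof.
move=> /lim_vnorm/lim_bounded[M sM]; exists M => k.
exact: Rle_trans (Rle_abs _) (sM k).
Qed.

(** * Neighbourhoods *)

Definition vnear {n} (x0 : vec n) (P : vec n -> Prop) : Prop :=
  exists r, 0 < r /\ forall x, vnorm (vsub x x0) < r -> P x.

Lemma vnear_imp n (x0 : vec n) (P Q : vec n -> Prop) :
  (forall x, P x -> Q x) -> vnear x0 P -> vnear x0 Q.
Proof. by move=> PQ [r [r_gt0 HP]]; exists r; split=> // x /HP/PQ. Qed.

Lemma vnear_and n (x0 : vec n) (P Q : vec n -> Prop) :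
  vnear x0 P -> vnear x0 Q -> vnear x0 (fun x => P x /\ Q x).
Proof.
move=> [r [r_gt0 HP]] [s [s_gt0 HQ]]; exists (Rmin r s).
split=> [|x x_lt]; first exact: Rmin_pos.
by have := Rmin_l r s; have := Rmin_r r s; split; [apply: HP|apply: HQ]; lra.
Qed.

Lemma vnear_forall_ord n p (x0 : vec n) (P : 'I_p -> vec n -> Prop) :
  (forall i, vnear x0 (P i)) -> vnear x0 (fun x => forall i, P i x).
Proof.
move=> nearP; suff : vnear x0 (fun x => forall i, i \in enum 'I_p -> P i x).
  by apply: vnear_imp => x Px i; apply: Px; rewrite mem_enum.
elim: (enum 'I_p) => [|i r IHr]; first by exists 1; split=> //; lra.
apply: vnear_imp (vnear_and (nearP i) IHr) => x [Pix Px] j.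
by rewrite inE => /orP[/eqP->|/Px].
Qed.

Lemma vnear_center n (x0 : vec n) P : vnear x0 P -> P x0.
Proof. by move=> [r [r_gt0 HP]]; apply: HP; rewrite vdist0. Qed.

Lemma vnear_ball n (x0 x : vec n) r : vnorm (vsub x x0) < r ->
  vnear x (fun y => vnorm (vsub y x0) < r).
Proof.
move=> x_lt; exists (r - vnorm (vsub x x0)); split=> [|y y_lt]; first lra.
by have := vdist_triangle y x x0; lra.
Qed.

Lemma vnear_interior n (x0 : vec n) P : vnear x0 P -> vnear x0 (fun x => vnear x P).
Proof.
by move=> [r [r_gt0 HP]]; exists r; split=> // x /vnear_ball; apply: vnear_imp.
Qed.

Lemma vlim_near n (s : nat -> vec n) x P : vlim s x -> vnear x P ->
  eventually (fun k => P (s k)).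
Proof.
move=> /vlim_dist sx [r [r_gt0 HP]].
apply: filter_imp (lim_near sx r_gt0) => k /Rabs_lt_between ?.
by apply: HP; lra.
Qed.

(** * Compactness *)

Definition vclosed {n} (C : vec n -> Prop) : Prop :=
  forall s x, vlim s x -> (forall k, C (s k)) -> C x.

Definition vcompact {n} (C : vec n -> Prop) : Prop :=
  forall s, (forall k, C (s k)) ->
  exists phi x, [/\ extraction phi, vlim (fun k => s (phi k)) x & C x].

Definition vcontinuous_on {n} (C : vec n -> Prop) (F : vec n -> R) : Prop :=
  forall s x, vlim s x -> (forall k, C (s k)) -> C x ->
  is_lim_seq (fun k => F (s k)) (F x).

Lemma vclosedI n (C D : vec n -> Prop) : vclosed C -> vclosed D ->
  vclosed (fun x => C x /\ D x).
Proof.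
move=> clC clD s x sx CDs.
by split; [apply: clC sx _|apply: clD sx _] => k; case: (CDs k).
Qed.

Lemma vclosed_ball n (x0 : vec n) r : vclosed (fun x => vnorm (vsub x x0) <= r).
Proof.
move=> s x sx sr.
exact: lim_le sr (lim_vnorm (vlimB sx (vlim_const x0))) (is_lim_seq_const r).
Qed.

Lemma bounded_seq_subseq u M : (forall k, Rabs (u k) <= M) ->
  exists phi (l : R), extraction phi /\ is_lim_seq (fun k => u (phi k)) l.
Proof.
move=> uM.
have [|l adh_l] := Bolzano_Weierstrass u _ (compact_P3 (- M) M).
  by move=> k; apply/Rabs_le_between/uM.
have close k : exists p, (k <= p)%coq_nat /\ Rabs (u p - l) <= inv_succ k.
  have [|p [le_kp up]] := adh_l (disc l (mkposreal _ (inv_succ_gt0 k))) k.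
    by exists (mkposreal _ (inv_succ_gt0 k)) => y.
  by exists p; split=> //; apply: Rlt_le.
have [phi Hphi] := choice _ close; exists phi, l; split.
  move=> P [N HN]; exists N => k le_Nk; apply: HN.
  by case: (Hphi k) => le_k _; apply: Nat.le_trans le_Nk le_k.
by apply: lim_of_dist lim_inv_succ _ => k; case: (Hphi k).
Qed.

Lemma bounded_seq_vsubseq n (s : nat -> vec n) M : (forall k, vnorm (s k) <= M) ->
  exists phi x, extraction phi /\ vlim (fun k => s (phi k)) x.
Proof.
move=> sM.
suff coords (r : seq 'I_n) : exists phi x, extraction phi /\
    forall i, i \in r -> is_lim_seq (fun k => s (phi k) i) (Finite (x i)).
  have [phi [x [ephi lim]]] := coords (enum 'I_n).
  by exists phi, x; split=> // i; apply: lim; rewrite mem_enum.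
elim: r => [|i r [phi [x [ephi lim]]]].
  by exists id, (@vzero n); split=> //; apply: filterlim_id.
have [k|psi [l [epsi liml]]] := @bounded_seq_subseq (fun k => s (phi k) i) M.
  exact: Rle_trans (coord_le_vnorm _ _) (sM _).
exists (fun k => phi (psi k)), (fun j => if j == i then l else x j).
split=> [|j]; first exact: extraction_comp.
rewrite inE; case: eqP => [-> //|_ /= jr].
exact: is_lim_seq_subseq epsi (lim _ jr).
Qed.

Lemma closed_bounded_compact n (C : vec n -> Prop) M : vclosed C ->
  (forall x, C x -> vnorm x <= M) -> vcompact C.
Proof.
move=> clC CM s Cs.
have [k|phi [x [ephi sx]]] := @bounded_seq_vsubseq _ s M; first exact: CM.
by exists phi, x; split=> //; apply: clC sx _.
Qed.

Lemma lim_Glb_Rbar (E : R -> Prop) : (exists t, E t) ->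
  exists u, (forall k, E (u k)) /\ is_lim_seq u (Glb_Rbar E).
Proof.
move=> [t0 Et0]; have [lbE glbE] := Glb_Rbar_correct E.
have below c : ~ Rbar_le (Finite c) (Glb_Rbar E) -> exists t, E t /\ t < c.
  move=> c_gt; apply: NNPP => no_t; apply/c_gt/glbE => t Et /=.
  by apply: Rnot_lt_le => t_lt; apply: no_t; exists t.
case: (Glb_Rbar E) lbE glbE below => [l lbE _ below|/(_ _ Et0) //|_ _ below].
  have near k : exists t, E t /\ t < l + inv_succ k.
    by apply: below => /=; have := inv_succ_gt0 k; lra.
  have [u Hu] := choice _ near; exists u; split=> [k|]; first by case: (Hu k).
  apply: lim_of_dist lim_inv_succ _ => k; case: (Hu k) => /lbE /= l_le u_lt.
  by apply: Rabs_le; lra.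
have low k : exists t, E t /\ t < - INR k by exact: below.
have [u Hu] := choice _ low; exists u; split=> [k|]; first by case: (Hu k).
apply: (is_lim_seq_le_m_loc (fun k => - INR k)).
  by exists O => k _; case: (Hu k) => _ /Rlt_le.
by apply/(is_lim_seq_opp INR p_infty)/is_lim_seq_INR.
Qed.

Lemma compact_min n (C : vec n -> Prop) (F : vec n -> R) x0 :
  vcompact C -> vcontinuous_on C F -> C x0 ->
  exists x, C x /\ forall y, C y -> F x <= F y.
Proof.
move=> cptC contF Cx0; pose E t := exists x, C x /\ t = F x.
have [|u [Eu lim_u]] := @lim_Glb_Rbar E; first by exists (F x0), x0.
have [s Hs] := choice _ Eu.
have [k|phi [x [ephi sx Cx]]] := cptC s; first by case: (Hs k).
exists x; split=> // y Cy.
have lim_F : is_lim_seq (fun k => u (phi k)) (F x).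
  apply: is_lim_seq_ext (contF _ _ sx _ Cx) => k; first by case: (Hs (phi k)).
  by case: (Hs (phi k)).
have := is_lim_seq_unique _ _ (is_lim_seq_subseq _ _ _ ephi lim_u).
rewrite (is_lim_seq_unique _ _ lim_F) => glb_E.
have [lbE _] := Glb_Rbar_correct E; rewrite -glb_E in lbE.
by apply: (lbE (F y)); exists y.
Qed.

(** * Second-order Taylor expansion *)

Lemma small_factor_exists r c t0 : 0 < r -> 0 <= c -> 0 < t0 ->
  exists t, [/\ 0 < t, t <= t0 & t * c < r].
Proof.
move=> r_gt0 c_ge0 t0_gt0; exists (Rmin t0 (r / (c + 1))).
have rc_gt0 : 0 < r / (c + 1) by apply: Rdiv_lt_0_compat; lra.
split; [exact: Rmin_pos|exact: Rmin_l|].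
have := Rmin_r t0 (r / (c + 1)); have := Rmin_pos _ _ t0_gt0 rc_gt0.
set t := Rmin _ _ => t_gt0 /(Rmult_le_compat_r (c + 1) _ _ ltac:(lra)).
by rewrite /Rdiv Rmult_assoc Rinv_l; lra.
Qed.

Lemma has_grad_near n (F : vec n -> R) x G : has_grad F x G ->
  forall eps, 0 < eps ->
  vnear x (fun y => Rabs (F y - F x - dot G (vsub y x)) <= eps * vnorm (vsub y x)).
Proof.
move=> gF eps /gF[r [r_gt0 Hr]]; exists r; split=> // y.
by move=> /Hr; rewrite vaddBK.
Qed.

Lemma has_grad_jac_near n p (G : vec n -> vec p) x A :
  (forall i, has_grad (fun y => G y i) x (A i)) ->
  forall eps, 0 < eps ->
  vnear x (fun y => vnorm (vsub (vsub (G y) (G x)) (jac_r A (vsub y x)))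
                    <= eps * vnorm (vsub y x)).
Proof.
move=> gG eps eps_gt0.
have [e [e_gt0 _ ep]] := small_factor_exists eps_gt0 (pos_INR p) Rlt_0_1.
have := vnear_forall_ord (fun i => has_grad_near (gG i) e_gt0).
apply: vnear_imp => y Gy; have := vnorm_ge0 (vsub y x) => yx_ge0.
have eyx_ge0 : 0 <= e * vnorm (vsub y x) by nra.
by apply: Rle_trans (vnorm_le_coord eyx_ge0 Gy) _; nra.
Qed.

Lemma has_grad_lim n (F : vec n -> R) x G s : has_grad F x G -> vlim s x ->
  is_lim_seq (fun k => F (s k)) (F x).
Proof.
move=> gF sx; apply/is_lim_seq_spec => eps.
have M_ge0 : 0 <= 1 + vnorm G by have := vnorm_ge0 G; lra.
have [d [d_gt0 _ dM]] := small_factor_exists (cond_pos eps) M_ge0 Rlt_0_1.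
have near_x : vnear x (fun y => vnorm (vsub y x) < d) by exists d.
have := vlim_near sx (vnear_and (has_grad_near gF Rlt_0_1) near_x).
apply: filter_imp => k [/Rabs_le_between le_F lt_d].
have /Rabs_le_between := Rabs_dot_le G (vsub (s k) x).
by have := vnorm_ge0 G => *; apply/Rabs_lt_between; split; nra.
Qed.

Lemma derivable_pt_lim_line n (F : vec n -> R) x d c G :
  has_grad F (vadd x (vscale c d)) G ->
  derivable_pt_lim (fun t => F (vadd x (vscale t d))) c (dot G d).
Proof.
move=> gF eps eps_gt0; have d_ge0 := vnorm_ge0 d.
have [e [e_gt0 _ ed]] := small_factor_exists eps_gt0 d_ge0 Rlt_0_1.
have [r [r_gt0 Hr]] := gF e e_gt0.
have [a [a_gt0 _ ad]] := small_factor_exists r_gt0 d_ge0 Rlt_0_1.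
exists (mkposreal _ a_gt0) => h h_neq0 /= h_lt.
have h_gt0 := Rabs_pos_lt _ h_neq0.
have {Hr} := Hr (vscale h d); rewrite vnormZ dotE => /(_ ltac:(nra)).
have -> : vadd (vadd x (vscale c d)) (vscale h d) = vadd x (vscale (c + h) d) by vext.
set u := F _ - F _ => le_u.
have -> : u / h - dot G d = (u - h * dot G d) / h by field.
by rewrite Rabs_div //; apply/Rlt_div_l => //; nra.
Qed.

Lemma derivable_pt_lim_sum n (u : 'I_n -> R -> R) c (l : 'I_n -> R) :
  (forall i, derivable_pt_lim (u i) c (l i)) ->
  derivable_pt_lim (fun t => \big[Rplus/0]_(i < n) u i t) c
    (\big[Rplus/0]_(i < n) l i).
Proof.
elim: n u l => [|n IHn] u l ul.
  rewrite big_ord0 (_ : (fun _ => _) = fct_cte 0); first exact: derivable_pt_lim_const.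
  by apply: functional_extensionality => t; rewrite big_ord0.
rewrite big_ord_recl.
rewrite (_ : (fun t => _) =
  (u ord0 + (fun t => \big[Rplus/0]_(i < n) u (lift ord0 i) t))%F).
  by apply: derivable_pt_lim_plus => //; apply: IHn.
by apply: functional_extensionality => t; rewrite big_ord_recl.
Qed.

Lemma derivable_pt_lim_grad_line n (DF : vec n -> vec n) x d c A :
  (forall i, has_grad (fun y => DF y i) (vadd x (vscale c d)) (A i)) ->
  derivable_pt_lim (fun t => dot (DF (vadd x (vscale t d))) d) c (quad A d).
Proof.
move=> gDF; rewrite -dot_quad; apply: derivable_pt_lim_sum => i.
rewrite (_ : (fun t => _) = mult_real_fct (d i) (fun t => DF (vadd x (vscale t d)) i)).
  by rewrite Rmult_comm; apply: derivable_pt_lim_scal (derivable_pt_lim_line (gDF i)).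
by apply: functional_extensionality => t; rewrite /mult_real_fct Rmult_comm.
Qed.

Lemma taylor2_unit_interval (phi phi' phi'' : R -> R) q e :
  (forall t, 0 <= t <= 1 -> derivable_pt_lim phi t (phi' t)) ->
  (forall t, 0 <= t <= 1 -> derivable_pt_lim phi' t (phi'' t)) ->
  (forall t, 0 <= t <= 1 -> Rabs (phi'' t - q) <= e) ->
  Rabs (phi 1 - phi 0 - phi' 0 - / 2 * q) <= e.
Proof.
move=> dphi dphi' phi''_q.
have first_order t : 0 < t < 1 -> Rabs (phi' t - phi' 0 - t * q) <= e.
  move=> t01; have [|c [-> c_t]] := @MVT_cor2 phi' phi'' 0 t t01.1.
    by move=> c c_t; apply: dphi'; lra.
  rewrite (_ : _ - _ = t * (phi'' c - q)); last ring.
  rewrite Rabs_mult Rabs_pos_eq; last lra.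
  have := phi''_q c ltac:(lra); have := Rabs_pos (phi'' c - q); nra.
have [|c [eqc c01]] := MVT_cor2 (fun t => phi t - t * phi' 0 - t ^ 2 / 2 * q)
    (fun t => phi' t - phi' 0 - t * q) 0 1 Rlt_0_1.
  move=> c c01; do ?apply: derivable_pt_lim_minus; first exact: dphi.
    by apply/is_derive_Reals; auto_derive => //; ring.
  by apply/is_derive_Reals; auto_derive => //; field.
have := first_order c c01.
by rewrite (_ : phi' c - _ - _ = phi 1 - phi 0 - phi' 0 - / 2 * q) //; lra.
Qed.

Lemma vdist_segment n (x y x0 : vec n) t r : 0 <= t <= 1 ->
  vnorm (vsub x x0) < r -> vnorm (vsub y x0) < r ->
  vnorm (vsub (vadd x (vscale t (vsub y x))) x0) < r.
Proof.
move=> t01 xr yr.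
have -> : vsub (vadd x (vscale t (vsub y x))) x0 =
  vadd (vscale (1 - t) (vsub x x0)) (vscale t (vsub y x0)) by vext.
apply: Rle_lt_trans (vnormD _ _) _; rewrite !vnormZ_ge0; try lra.
by case: (Req_dec t 0) => ?; nra.
Qed.

Section C2.

Variables (n : nat) (F : vec n -> R) (DF : vec n -> vec n) (D2F : vec n -> mat n).
Variable x0 : vec n.
Hypothesis C2F : C2_with F DF D2F x0.

Let C2_near : vnear x0 (fun x => has_grad F x (DF x) /\
  (forall i, has_grad (fun y => DF y i) x (D2F x i)) /\
  (forall i j, cont_at (fun y => D2F y i j) x)) := C2F.

Lemma C2_has_grad : vnear x0 (fun x => has_grad F x (DF x)).
Proof. by apply: vnear_imp C2_near => x []. Qed.

Lemma C2_hess_near e : 0 < e ->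
  vnear x0 (fun x => forall i j, Rabs (D2F x i j - D2F x0 i j) <= e).
Proof.
move=> e_gt0; apply: vnear_forall_ord => i; apply: vnear_forall_ord => j.
have [_ [_ cont_D2F]] := vnear_center C2_near.
have [r [r_gt0 Hr]] := cont_D2F i j e e_gt0.
by exists r; split=> // x /Hr/Rlt_le.
Qed.

Lemma C2_lim s : vlim s x0 -> is_lim_seq (fun k => F (s k)) (F x0).
Proof. exact: has_grad_lim (vnear_center C2_has_grad). Qed.

Lemma C2_grad_vlim s : vlim s x0 -> vlim (fun k => DF (s k)) (DF x0).
Proof.
move=> sx0 i; have [_ [gDF _]] := vnear_center C2_near.
exact: has_grad_lim (gDF i) sx0.
Qed.

Lemma C2_taylor2 eps : 0 < eps -> exists r, 0 < r /\ forall x y,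
  vnorm (vsub x x0) < r -> vnorm (vsub y x0) < r ->
  Rabs (F y - F x - dot (DF x) (vsub y x) - / 2 * quad (D2F x0) (vsub y x))
    <= eps * vnorm (vsub y x) ^ 2.
Proof.
move=> eps_gt0; have n2_ge0 : 0 <= INR n ^ 2 := pow2_ge_0 _.
have [e [e_gt0 _ e_lt]] := small_factor_exists eps_gt0 n2_ge0 Rlt_0_1.
have [r [r_gt0 near_x0]] := vnear_and C2_near (C2_hess_near e_gt0).
exists r; split=> // x y x_r y_r; set d := vsub y x.
have near_seg t : 0 <= t <= 1 -> _ :=
  fun t01 => near_x0 _ (vdist_segment t01 x_r y_r).
have := @taylor2_unit_interval (fun t => F (vadd x (vscale t d)))
  (fun t => dot (DF (vadd x (vscale t d))) d)
  (fun t => quad (D2F (vadd x (vscale t d))) d)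
  (quad (D2F x0) d) (eps * vnorm d ^ 2).
rewrite (_ : vadd x (vscale 0 d) = x); last by vext.
rewrite (_ : vadd x (vscale 1 d) = y); last by rewrite /d; vext.
apply=> t /near_seg [[gF [gDF _]] hess_near].
- exact: derivable_pt_lim_line.
- exact: derivable_pt_lim_grad_line.
rewrite (_ : _ - _ = quad (fun i j => D2F (vadd x (vscale t d)) i j +
  -1 * D2F x0 i j) d); last by rewrite quadD quad_scale; ring.
apply: Rle_trans (Rabs_quad_le _ (Rlt_le _ _ e_gt0) _) _.
  move=> i j; have := hess_near i j; set a := D2F _ i j; set b := D2F _ i j.
  by rewrite (_ : a + -1 * b = a - b) //; ring.
by apply: Rmult_le_compat_r; [exact: pow2_ge_0|lra].
Qed.

Section Quotients.

Variables (x w : nat -> vec n) (t : nat -> R) (w0 : vec n).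
Hypotheses (lim_x : vlim x x0) (lim_w : vlim w w0).
Hypotheses (t_gt0 : forall k, 0 < t k) (lim_t : is_lim_seq t 0).

Let y k := vadd (x k) (vscale (t k) (w k)).

Lemma vlim_shift : vlim y x0.
Proof. by rewrite (_ : x0 = vadd x0 (vscale 0 w0)); [exact/vlimD/vlimZ|vext]. Qed.

Definition taylor2_quotient k : R :=
  (F (y k) - F (x k) - t k * dot (DF (x k)) (w k)) / t k ^ 2.

Lemma lim_taylor2_quotient : is_lim_seq taylor2_quotient (/ 2 * quad (D2F x0) w0).
Proof.
pose q k := / 2 * quad (D2F x0) (w k).
apply: (is_lim_seq_ext (fun k => (taylor2_quotient k - q k) + q k)) => [k|]; first ring.
rewrite -[X in is_lim_seq _ (Finite X)]Rplus_0_l; apply: is_lim_seq_plus'; last first.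
  by apply: is_lim_seq_mult'; [exact: is_lim_seq_const|exact: lim_quad].
apply/is_lim_seq_spec => eps; have [M wM] := vlim_bounded lim_w.
have [e [e_gt0 _ e_lt]] := small_factor_exists (cond_pos eps) (pow2_ge_0 M) Rlt_0_1.
have [r [r_gt0 taylor]] := C2_taylor2 e_gt0.
have near_x0 : vnear x0 (fun z => vnorm (vsub z x0) < r) by exists r.
have x_near := vlim_near lim_x near_x0; have y_near := vlim_near vlim_shift near_x0.
apply: filter_imp (filter_and _ _ x_near y_near) => k [x_r y_r].
have := taylor _ _ x_r y_r; have tk := t_gt0 k.
rewrite vaddK dotE vnormZ_ge0 ?quadZ; last lra.
set a := F _ - F _ - _ => le_a.
have -> : taylor2_quotient k - q k - 0 =
    (a - / 2 * (t k ^ 2 * quad (D2F x0) (w k))) / t k ^ 2.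
  by rewrite /taylor2_quotient /q -/a; field; lra.
have t2_gt0 : 0 < t k ^ 2 by apply: pow_lt.
rewrite Rabs_div ?(Rabs_pos_eq (t k ^ 2)); [|lra|lra].
apply/Rlt_div_l => //; apply: Rle_lt_trans le_a _.
have w2_le : vnorm (w k) ^ 2 <= M ^ 2.
  by apply: pow_incr; split; [exact: vnorm_ge0|exact: wM].
have ew_lt : e * vnorm (w k) ^ 2 < eps by nra.
rewrite (_ : e * _ = t k ^ 2 * (e * vnorm (w k) ^ 2)) ?(Rmult_comm eps); last ring.
exact: Rmult_lt_compat_l.
Qed.

Lemma lim_diff_quotient :
  is_lim_seq (fun k => (F (y k) - F (x k)) / t k) (dot (DF x0) w0).
Proof.
have lim_D := lim_dot (C2_grad_vlim lim_x) lim_w.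
have lim_tq := is_lim_seq_mult' _ _ _ _ lim_t lim_taylor2_quotient.
have := is_lim_seq_plus' _ _ _ _ lim_D lim_tq.
rewrite Rmult_0_l Rplus_0_r; apply: is_lim_seq_ext => k.
by rewrite /taylor2_quotient; field; have := t_gt0 k; lra.
Qed.

End Quotients.

End C2.

Definition C2_map {n p} (G : vec n -> vec p) (DG : vec n -> 'I_p -> vec n)
    (D2G : vec n -> 'I_p -> mat n) (x0 : vec n) : Prop :=
  forall i, C2_with (fun x => G x i) (fun x => DG x i) (fun x => D2G x i) x0.

Section C2Map.

Variables (n p : nat) (G : vec n -> vec p) (DG : vec n -> 'I_p -> vec n).
Variables (D2G : vec n -> 'I_p -> mat n) (x0 : vec n).
Hypothesis C2G : C2_map G DG D2G x0.

Lemma C2_map_has_grad :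
  vnear x0 (fun x => forall i, has_grad (fun y => G y i) x (DG x i)).
Proof. exact: vnear_forall_ord (fun i => C2_has_grad (C2G i)). Qed.

Lemma C2_map_vlim s : vlim s x0 -> vlim (fun k => G (s k)) (G x0).
Proof. by move=> sx0 i; apply: C2_lim (C2G i) _ sx0. Qed.

Lemma jac_quotient_vlim x w t w0 : vlim x x0 -> vlim w w0 ->
  (forall k, 0 < t k) -> is_lim_seq t 0 ->
  vlim (fun k => vscale (/ t k) (vsub (G (vadd (x k) (vscale (t k) (w k)))) (G (x k))))
    (jac_r (DG x0) w0).
Proof.
move=> lim_x lim_w t_gt0 lim_t i.
apply: is_lim_seq_ext (lim_diff_quotient (C2G i) lim_x lim_w t_gt0 lim_t) => k.
by rewrite /vscale /vsub Rmult_comm.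
Qed.

End C2Map.

(** * Convex cones and projections *)

Definition vconvex {p} (C : vec p -> Prop) : Prop :=
  forall x y t, 0 <= t <= 1 -> C x -> C y ->
  C (vadd (vscale (1 - t) x) (vscale t y)).

Definition convex_cone {p} (K : vec p -> Prop) : Prop :=
  [/\ K (@vzero p), (forall a x, 0 <= a -> K x -> K (vscale a x))
    & (forall x y, K x -> K y -> K (vadd x y))].

Definition polar {p} (K : vec p -> Prop) (l : vec p) : Prop :=
  forall q, K q -> dot l q <= 0.

Lemma convex_cone_convex p (K : vec p -> Prop) : convex_cone K -> vconvex K.
Proof. by move=> [_ KZ KD] x y t t01 Kx Ky; apply: KD; apply: KZ => //; lra. Qed.

Lemma polar_convex_cone p (K : vec p -> Prop) : convex_cone (polar K).
Proof.
split=> [q _|a l a_ge0 pol q Kq|l l' pol pol' q Kq]; rewrite !dotE; first lra.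
  by have := pol q Kq; nra.
by have := pol q Kq; have := pol' q Kq; lra.
Qed.

Lemma polar_closed p (K : vec p -> Prop) : vclosed (polar K).
Proof.
move=> s l sl pol q Kq.
by apply: lim_le (lim_dot sl (vlim_const q)) (is_lim_seq_const 0) => k; apply: pol.
Qed.

Lemma le0_of_quadratic a b :
  (forall s, 0 < s <= 1 -> 0 <= s ^ 2 * b - 2 * s * a) -> a <= 0.
Proof.
move=> quad_ge0; apply: Rnot_lt_le => a_gt0.
have [||s [s_gt0 s_le1 sb_lt]] := @small_factor_exists (2 * a) (Rabs b) 1 _ _ Rlt_0_1.
- lra.
- exact: Rabs_pos.
have := quad_ge0 s (conj s_gt0 s_le1); have := Rle_abs b; nra.
Qed.

Lemma le_of_le_eps a b c : (forall eps, 0 < eps <= 1 -> a <= b + c * eps) -> a <= b.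
Proof.
move=> le_eps; apply: Rnot_lt_le => lt_ba.
have [||e [e_gt0 e_le1 ec_lt]] := @small_factor_exists (a - b) (Rabs c) 1 _ _ Rlt_0_1.
- lra.
- exact: Rabs_pos.
have := le_eps e (conj e_gt0 e_le1); have := Rle_abs c; nra.
Qed.

Lemma closest_point_exists p (C : vec p -> Prop) a c : vclosed C -> C c ->
  exists x, C x /\ forall y, C y -> vnorm (vsub x a) <= vnorm (vsub y a).
Proof.
move=> clC Cc; pose B y := C y /\ vnorm (vsub y a) <= vnorm (vsub c a).
have cptB : vcompact B.
  apply: (@closed_bounded_compact _ _ (vnorm a + vnorm (vsub c a))).
    by apply: vclosedI => //; apply: vclosed_ball.
  by move=> y [_ y_le]; have := vnormD a (vsub y a); rewrite vaddBK; lra.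
have [||x [[Cx x_le] x_min]] :=
    compact_min (F := fun y => vnorm (vsub y a)) (x0 := c) cptB.
- by move=> s y sy _ _; apply/lim_vnorm/vlimB/vlim_const.
- by split=> //; lra.
exists x; split=> // y Cy.
by case: (Rle_dec (vnorm (vsub y a)) (vnorm (vsub c a))) => ?; [apply: x_min|lra].
Qed.

Lemma closest_point_normal p (C : vec p -> Prop) a x : vconvex C -> C x ->
  (forall y, C y -> vnorm (vsub x a) <= vnorm (vsub y a)) ->
  forall y, C y -> dot (vsub a x) (vsub y x) <= 0.
Proof.
move=> cvxC Cx x_min y Cy; set d := vsub y x.
apply: (@le0_of_quadratic _ (dot d d)) => s s01.
have := x_min _ (cvxC x y s (conj (Rlt_le _ _ s01.1) s01.2) Cx Cy).
have -> : vsub (vadd (vscale (1 - s) x) (vscale s y)) a = vadd (vsub x a) (vscale s d).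
  by rewrite /d; vext.
move/(fun h => pow_incr _ _ 2 (conj (vnorm_ge0 _) h)); rewrite !vnorm_sqr.
by clearbody d; rewrite !dotE (dotC d x) (dotC d a); lra.
Qed.

Lemma moreau_decomposition p (K : vec p -> Prop) a : convex_cone K -> vclosed K ->
  exists x, [/\ K x, polar K (vsub a x) & dot (vsub a x) x = 0].
Proof.
move=> cK clK; have [K0 KZ KD] := cK.
have [x [Kx x_min]] := closest_point_exists a clK K0.
have normal := closest_point_normal (convex_cone_convex cK) Kx x_min.
exists x; split=> // [q Kq|].
  have := normal _ (KD _ _ Kx Kq).
  by rewrite (_ : vsub (vadd x q) x = q) //; vext.
have := normal _ K0; have := normal _ (KZ 2 x ltac:(lra) Kx).
by rewrite !dotE; lra.
Qed.

Definition vclosure {p} (C : vec p -> Prop) (x : vec p) : Prop :=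
  forall eps, 0 < eps -> exists y, C y /\ vnorm (vsub y x) < eps.

Lemma vclosure_sub p (C : vec p -> Prop) x : C x -> vclosure C x.
Proof. by move=> Cx eps eps_gt0; exists x; rewrite vdist0. Qed.

Lemma vclosure_closed p (C : vec p -> Prop) : vclosed (vclosure C).
Proof.
move=> s x sx Cs eps eps_gt0.
have eps2 : 0 < eps / 2 by lra.
have near_x : vnear x (fun y => vnorm (vsub y x) < eps / 2) by exists (eps / 2).
have [N /(_ N (Nat.le_refl _)) sN] := vlim_near sx near_x.
have [y [Cy y_lt]] := Cs N _ eps2; exists y; split=> //.
by have := vdist_triangle y (s N) x; lra.
Qed.

Lemma vclosure_convex_cone p (K : vec p -> Prop) :
  convex_cone K -> convex_cone (vclosure K).
Proof.
move=> [K0 KZ KD]; split=> [|a x a_ge0 clx|x y clx cly]; first exact: vclosure_sub.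
- move=> eps eps_gt0; have [e [e_gt0 _ ea]] := small_factor_exists eps_gt0 a_ge0 Rlt_0_1.
  have [y [Ky y_lt]] := clx e e_gt0; exists (vscale a y); split; first exact: KZ.
  rewrite (_ : vsub _ _ = vscale a (vsub y x)) ?vnormZ_ge0 //; last by vext.
  by have := vnorm_ge0 (vsub y x); nra.
- move=> eps eps_gt0; have eps2 : 0 < eps / 2 by lra.
  have [x' [Kx' x'_lt]] := clx _ eps2; have [y' [Ky' y'_lt]] := cly _ eps2.
  exists (vadd x' y'); split; first exact: KD.
  have -> : vsub (vadd x' y') (vadd x y) = vadd (vsub x' x) (vsub y' y) by vext.
  by have := vnormD (vsub x' x) (vsub y' y); lra.
Qed.

Definition radial_cone {p} (K : vec p -> Prop) (z w : vec p) : Prop :=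
  exists k a, [/\ K k, 0 <= a & w = vsub k (vscale a z)].

Section RadialCone.

Variables (p : nat) (K : vec p -> Prop) (z : vec p).
Hypotheses (cK : convex_cone K) (Kz : K z).

Lemma radial_cone_convex_cone : convex_cone (radial_cone K z).
Proof.
have [K0 KZ KD] := cK.
split=> [|b _ b_ge0 [k [a [Kk a_ge0 ->]]]|].
- by exists (@vzero p), 0; split=> //; [lra|vext].
- by exists (vscale b k), (b * a); split; [exact: KZ|nra|vext].
- move=> _ _ [k [a [Kk a_ge0 ->]]] [k' [a' [Kk' a'_ge0 ->]]].
  by exists (vadd k k'), (a + a'); split; [exact: KD|lra|vext].
Qed.

Lemma radial_cone_step w : radial_cone K z w ->
  exists t0, 0 < t0 /\ forall t, 0 < t <= t0 -> K (vadd z (vscale t w)).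
Proof.
have [_ KZ KD] := cK; move=> [k [a [Kk a_ge0 ->]]].
have [t0 [t0_gt0 _ t0a]] := small_factor_exists Rlt_0_1 a_ge0 Rlt_0_1.
exists t0; split=> // t t_le.
have -> : vadd z (vscale t (vsub k (vscale a z))) =
  vadd (vscale (1 - t * a) z) (vscale t k) by vext.
by apply: KD; apply: KZ => //; nra.
Qed.

Lemma polar_radial_cone l : polar (radial_cone K z) l -> polar K l /\ dot l z = 0.
Proof.
move=> pol; have [K0 _ _] := cK.
have polK : polar K l.
  by move=> k Kk; apply: pol; exists k, 0; split=> //; [lra|vext].
split=> //; apply: Rle_antisym; first exact: polK.
have /pol : radial_cone K z (vsub (@vzero p) z).
  by exists (@vzero p), 1; split=> //; [lra|vext].
by rewrite !dotE; lra.
Qed.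

End RadialCone.

(** * Multipliers of regular normals under an error bound *)

Definition error_bound {n p} (K : vec p -> Prop) (G : vec n -> vec p) (s : R)
    (x : vec n) : Prop :=
  vnear x (fun y => forall q, K q ->
    exists z, K (G z) /\ vnorm (vsub y z) <= s * vnorm (vsub (G y) q)).

Lemma reg_normal_near n (C : vec n -> Prop) x v : reg_normal C x v ->
  forall eps, 0 < eps ->
  vnear x (fun y => C y -> dot v (vsub y x) <= eps * vnorm (vsub y x)).
Proof.
by move=> [_ nv] eps /nv[r [r_gt0 Hr]]; exists r; split=> // y y_lt Cy; apply: Hr.
Qed.

(* Otherwise [v] would be strictly separated from the image of [C] under [adj A]. *)
Lemma adj_image_of_support n p (A : 'I_p -> vec n) (C : vec p -> Prop) c v :
  vcompact C -> vconvex C -> C c ->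
  (forall h, exists l, C l /\ dot v h <= dot l (jac_r A h)) ->
  exists l, C l /\ v = adj A l.
Proof.
move=> cptC cvxC Cc dom; pose D x := exists l, C l /\ x = adj A l.
have clD : vclosed D.
  move=> s x sx /choice[l Hl].
  have [k|phi [l0 [ephi lim_l Cl0]]] := cptC l; first by case: (Hl k).
  have lim_adj := vlim_adj (A := fun=> A) (fun j => vlim_const (A j)) lim_l.
  exists l0; split=> //; apply: vlim_unique (vlim_subseq ephi sx) _ => i.
  by apply: is_lim_seq_ext (lim_adj i) => k; case: (Hl (phi k)) => _ ->.
have cvxD : vconvex D.
  move=> _ _ t t01 [l [Cl ->]] [l' [Cl' ->]].
  exists (vadd (vscale (1 - t) l) (vscale t l')).
  by rewrite adjD !adjZ; split=> //; apply: cvxC.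
have Dc : D (adj A c) by exists c.
have [x [Dx x_min]] := closest_point_exists v clD Dc.
suff -> : v = x by [].
have [l [Cl le_vh]] := dom (vsub v x).
have Dl : D (adj A l) by exists l.
have := closest_point_normal cvxD Dx x_min Dl.
rewrite -dot_adj in le_vh; move: le_vh; set h := vsub v x => le_vh normal.
apply/vsub_eq0/vnorm_eq0; rewrite -/h.
have hh : dot h h = dot v h - dot h x by rewrite {1}/h dotBl (dotC h x).
rewrite dotBr (dotC h (adj A l)) in normal.
by have := vnorm_sqr h; have := vnorm_ge0 h; nra.
Qed.

Section NormalMultiplier.

Variables (n p : nat) (K : vec p -> Prop) (G : vec n -> vec p) (A : 'I_p -> vec n).
Variables (x v : vec n) (s : R).
Hypothesis gG : forall i, has_grad (fun y => G y i) x (A i).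
Hypothesis s_ge0 : 0 <= s.
Hypothesis errb : error_bound K G s x.
Hypothesis nv : reg_normal (fun y => K (G y)) x v.

(* Move to [x + t h] and correct it to a feasible point: since [G x + t w] lies in
   [K], the error bound makes the correction at most [s t (|A h - w| + o(1))]. *)
Lemma reg_normal_feasible_direction h w t0 : 0 < t0 ->
  (forall t, 0 < t <= t0 -> K (vadd (G x) (vscale t w))) ->
  dot v h <= s * vnorm v * vnorm (vsub (jac_r A h) w).
Proof.
move=> t0_gt0 Kw; set D := vnorm (vsub _ _); have D_ge0 : 0 <= D := vnorm_ge0 _.
have h_ge0 := vnorm_ge0 h; have v_ge0 := vnorm_ge0 v.
have sDh_ge0 : 0 <= s * (D + vnorm h) by nra.
pose c := vnorm h + s * (D + vnorm h); have c_ge0 : 0 <= c by rewrite /c; lra.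
apply: (@le_of_le_eps _ _ (s * vnorm v * vnorm h + c)) => eps eps01.
have [r [r_gt0 near_x]] :=
  vnear_and (reg_normal_near nv eps01.1) (vnear_and errb (has_grad_jac_near gG eps01.1)).
have [t [t_gt0 t_le tc]] := small_factor_exists r_gt0 c_ge0 t0_gt0.
pose y := vadd x (vscale t h).
have yx : vnorm (vsub y x) = t * vnorm h by rewrite vaddK vnormZ_ge0; lra.
have [|_ [errb_y grad_y]] := near_x y; first by rewrite yx /c in tc *; nra.
have [z [Kz yz]] := errb_y _ (Kw t (conj t_gt0 t_le)).
have {}yz : vnorm (vsub y z) <= t * (s * (D + eps * vnorm h)).
  apply: Rle_trans yz _; rewrite -Rmult_assoc (Rmult_comm t) Rmult_assoc.
  apply: Rmult_le_compat_l => //.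
  rewrite (_ : vsub (G y) _ = vadd (vsub (vsub (G y) (G x)) (jac_r A (vsub y x)))
    (vscale t (vsub (jac_r A h) w))); last by rewrite vaddK jacZ; vext.
  apply: Rle_trans (vnormD _ _) _; rewrite vnormZ_ge0 -/D; last lra.
  by rewrite yx in grad_y; lra.
have zx : vnorm (vsub z x) <= t * c.
  have := vdist_triangle z y x; rewrite (vdistC z y) yx /c => ?.
  have : s * (D + eps * vnorm h) <= s * (D + vnorm h) by apply: Rmult_le_compat_l; nra.
  by nra.
have [/(_ Kz) normal_z _] := near_x z (Rle_lt_trans _ _ _ zx tc).
have := dot_le_vnorm v (vsub y z).
have -> : dot v (vsub y z) = t * dot v h - dot v (vsub z x) by rewrite /y !dotE; ring.
have : vnorm v * vnorm (vsub y z) <= vnorm v * (t * (s * (D + eps * vnorm h))).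
  exact: Rmult_le_compat_l.
have : eps * vnorm (vsub z x) <= eps * (t * c) by apply: Rmult_le_compat_l; lra.
by move=> *; apply: (Rmult_le_reg_l t) => //; lra.
Qed.

Lemma reg_normal_radial_closure h w : convex_cone K -> vclosure (radial_cone K (G x)) w ->
  dot v h <= s * vnorm v * vnorm (vsub (jac_r A h) w).
Proof.
move=> cK clw; apply: (@le_of_le_eps _ _ (s * vnorm v)) => eps [eps_gt0 _].
have [w' [/(radial_cone_step cK nv.1)[t0 [t0_gt0 Kw']] w'_lt]] := clw eps eps_gt0.
apply: Rle_trans (reg_normal_feasible_direction h t0_gt0 Kw') _.
rewrite -Rmult_plus_distr_l; apply: Rmult_le_compat_l.
  by apply: Rmult_le_pos => //; apply: vnorm_ge0.
by have := vdist_triangle (jac_r A h) w w'; rewrite (vdistC w w'); lra.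
Qed.

Definition bounded_multiplier (M : R) (l : vec p) : Prop :=
  (polar K l /\ dot l (G x) = 0) /\ vnorm l <= M.

Lemma bounded_multiplier_compact M : vcompact (bounded_multiplier M).
Proof.
apply: (@closed_bounded_compact _ _ M) => [|l [] //].
do ?apply: vclosedI; first exact: polar_closed.
  move=> l l0 lim_l lG; apply: lim_unique (lim_dot lim_l (vlim_const _)) _.
  by apply: is_lim_seq_ext (is_lim_seq_const 0) => k; rewrite lG.
by move=> l l0 lim_l lM; apply: lim_le lM (lim_vnorm lim_l) (is_lim_seq_const M).
Qed.

Lemma bounded_multiplier_convex M : vconvex (bounded_multiplier M).
Proof.
move=> l l' t t01 [[pol lG] lM] [[pol' l'G] l'M]; split; first split.
- exact: (convex_cone_convex (polar_convex_cone K)).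
- by rewrite !dotE lG l'G; ring.
- by apply: Rle_trans (vnormD _ _) _; rewrite !vnormZ_ge0; [nra|lra|lra].
Qed.

Lemma bounded_multiplier0 M : 0 <= M -> bounded_multiplier M (@vzero p).
Proof.
by move=> M_ge0; split; rewrite ?vnorm0 //; split=> [q _|]; rewrite dot0l; lra.
Qed.

(* The residual of the projection of [A h] onto the closed radial cone is the
   multiplier, up to scaling. *)
Lemma reg_normal_support_le h : convex_cone K ->
  exists l, bounded_multiplier (s * vnorm v) l /\ dot v h <= dot l (jac_r A h).
Proof.
move=> cK; have sv_ge0 : 0 <= s * vnorm v := Rmult_le_pos _ _ s_ge0 (vnorm_ge0 v).
have cR := vclosure_convex_cone (radial_cone_convex_cone (G x) cK).
have [w [clw pol_cl orth]] := moreau_decomposition (jac_r A h) cR (@vclosure_closed _ _).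
have := reg_normal_radial_closure h cK clw; set r := vsub _ w in pol_cl orth * => vh_le.
have [polK rG] : polar K r /\ dot r (G x) = 0.
  by apply: (polar_radial_cone cK nv.1) => q Rq; apply/pol_cl/vclosure_sub.
have [r_gt0|/esym/vnorm_eq0 r0] := vnorm_ge0 r; last first.
  exists (@vzero p); split; first exact: bounded_multiplier0.
  by rewrite r0 vnorm0 in vh_le; rewrite dot0l; lra.
have c_ge0 : 0 <= s * vnorm v / vnorm r by apply: Rdiv_le_0_compat.
exists (vscale (s * vnorm v / vnorm r) r); split; [split; [split|]|].
- by have [_ polZ _] := polar_convex_cone K; apply: polZ.
- by rewrite dotZl rG; ring.
- by rewrite vnormZ_ge0 // /Rdiv Rmult_assoc Rinv_l; lra.
- have rAh : dot r (jac_r A h) = vnorm r ^ 2.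
    by rewrite vnorm_sqr {3}/r dotBr orth; ring.
  by rewrite dotZl rAh; apply: Rle_trans vh_le _; right; field; lra.
Qed.

Lemma reg_normal_multiplier : convex_cone K ->
  exists l, bounded_multiplier (s * vnorm v) l /\ v = adj A l.
Proof.
move=> cK; apply: (adj_image_of_support (c := @vzero p)).
- exact: bounded_multiplier_compact.
- exact: bounded_multiplier_convex.
- exact/bounded_multiplier0/Rmult_le_pos/vnorm_ge0.
- by move=> h; apply: reg_normal_support_le.
Qed.

End NormalMultiplier.

(** * Stationary points of the tilted problems *)

Section Stationarity.

Variables (n p : nat) (K : vec p -> Prop).
Variables (Df : vec n -> vec n) (G : vec n -> vec p) (DG : vec n -> 'I_p -> vec n).
Variables (D2G : vec n -> 'I_p -> mat n) (xbar : vec n) (s : R).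

Record KKT (x v : vec n) (l : vec p) : Prop := {
  KKT_feasible : K (G x);
  KKT_polar : polar K l;
  KKT_compl : dot l (G x) = 0;
  KKT_bound : vnorm l <= s * vnorm (vsub v (Df x));
  KKT_grad : vsub v (Df x) = adj (DG x) l }.

Hypothesis C2G : C2_map G DG D2G xbar.
Hypothesis s_ge0 : 0 <= s.

Lemma KKT_of_reg_normal : convex_cone K -> error_bound K G s xbar ->
  vnear xbar (fun x => forall v,
    reg_normal (fun y => K (G y)) x (vsub v (Df x)) -> exists l, KKT x v l).
Proof.
move=> cK errb.
apply: vnear_imp (vnear_and (vnear_interior errb) (C2_map_has_grad C2G)).
move=> x [errb_x gG] v nv.
have [l [[[pol compl] bound] grad]] := reg_normal_multiplier gG s_ge0 errb_x nv cK.
by exists l; split=> //; case: nv.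
Qed.

Variables (f : vec n -> R) (D2f : vec n -> mat n).
Hypothesis C2f : C2_with f Df D2f xbar.
Hypothesis clK : vclosed K.

Lemma KKT_limit x v l v0 l0 : vlim x xbar -> vlim v v0 -> vlim l l0 ->
  (forall k, KKT (x k) (v k) (l k)) -> KKT xbar v0 l0.
Proof.
move=> lim_x lim_v lim_l kkt.
have lim_G := C2_map_vlim C2G lim_x.
have lim_residual := vlimB lim_v (C2_grad_vlim C2f lim_x); split.
- by apply: clK lim_G _ => k; apply: KKT_feasible (kkt k).
- by apply: polar_closed lim_l _ => k; apply: KKT_polar (kkt k).
- apply: lim_unique (lim_dot lim_l lim_G) _; apply: is_lim_seq_ext (is_lim_seq_const 0) => k.
  by rewrite (KKT_compl (kkt k)).
- apply: lim_le (fun k => KKT_bound (kkt k)) (lim_vnorm lim_l) _.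
  by apply: is_lim_seq_mult' (lim_vnorm lim_residual); apply: is_lim_seq_const.
- have lim_DG j := C2_grad_vlim (C2G j) lim_x.
  have lim_adj := vlim_adj (A := fun k => DG (x k)) lim_DG lim_l.
  apply: vlim_unique lim_residual _ => i.
  by apply: is_lim_seq_ext (lim_adj i) => k; rewrite (KKT_grad (kkt k)).
Qed.

Lemma KKT_subseq_limit x v l v0 : vlim x xbar -> vlim v v0 ->
  (forall k, KKT (x k) (v k) (l k)) ->
  exists phi l0, [/\ extraction phi, vlim (fun k => l (phi k)) l0 & KKT xbar v0 l0].
Proof.
move=> lim_x lim_v kkt.
have [M leM] := vlim_bounded (vlimB lim_v (C2_grad_vlim C2f lim_x)).
have [k|phi [l0 [ephi lim_l]]] := @bounded_seq_vsubseq _ l (s * M).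
  by apply: Rle_trans (KKT_bound (kkt k)) _; apply: Rmult_le_compat_l.
exists phi, l0; split=> //.
by apply: KKT_limit (vlim_subseq ephi lim_x) (vlim_subseq ephi lim_v) lim_l _ => k.
Qed.

Lemma KKT_of_lim_normal : convex_cone K -> error_bound K G s xbar ->
  lim_normal (fun y => K (G y)) xbar (vopp (Df xbar)) ->
  exists l, KKT xbar (@vzero n) l.
Proof.
move=> cK errb [_ [x [u [nu [/seq_cv_vlim lim_x /seq_cv_vlim lim_u]]]]].
pose v k := vadd (u k) (Df (x k)).
have lim_v : vlim v (@vzero n).
  rewrite (_ : @vzero n = vadd (vopp (Df xbar)) (Df xbar)); last by vext.
  exact: vlimD lim_u (C2_grad_vlim C2f lim_x).
have [N HN] := vlim_near lim_x (KKT_of_reg_normal cK errb).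
have eN := extraction_shift N.
have ex_l k : exists l, KKT (x (k + N)%coq_nat) (v (k + N)%coq_nat) l.
  apply: HN; first exact: Nat.le_add_l.
  by rewrite (_ : vsub _ _ = u (k + N)%coq_nat); [exact: nu|rewrite /v; vext].
have [l kkt] := choice _ ex_l.
have [_ [l0 [_ _ kkt0]]] :=
  KKT_subseq_limit (vlim_subseq eN lim_x) (vlim_subseq eN lim_v) kkt.
by exists l0.
Qed.

End Stationarity.

Definition lagrangian_hess {n p} (A : mat n) (B : 'I_p -> mat n) (l : vec p)
    (u : vec n) : R :=
  quad A u + dot l (fun i => quad (B i) u).

Definition quad_growth {n} (f : vec n -> R) (kappa : R) (x v y : vec n) : Prop :=
  f x + dot v (vsub y x) + vnorm (vsub y x) ^ 2 / (2 * kappa) <= f y.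

(* If quadratic growth fails along a sequence, then the multiplier gap
   [- <l_k, G y_k> / t_k^2] stays bounded, so the limit [w0] of the directions is
   critical, and the expansion of the Lagrangian bounds its curvature. *)
Section GrowthFailure.

Variables (n p : nat) (K : vec p -> Prop).
Variables (f : vec n -> R) (Df : vec n -> vec n) (D2f : vec n -> mat n).
Variables (G : vec n -> vec p) (DG : vec n -> 'I_p -> vec n).
Variables (D2G : vec n -> 'I_p -> mat n) (xbar : vec n) (s kappa : R).
Hypothesis C2f : C2_with f Df D2f xbar.
Hypothesis C2G : C2_map G DG D2G xbar.

Variables (x v w : nat -> vec n) (t : nat -> R) (l : nat -> vec p).
Variables (w0 : vec n) (l0 : vec p).
Hypotheses (lim_x : vlim x xbar) (lim_w : vlim w w0) (lim_l : vlim l l0).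
Hypotheses (t_gt0 : forall k, 0 < t k) (lim_t : is_lim_seq t 0).
Hypothesis w1 : forall k, vnorm (w k) = 1.

Let y k := vadd (x k) (vscale (t k) (w k)).

Hypothesis kkt : forall k, KKT K Df G DG s (x k) (v k) (l k).
Hypothesis Ky : forall k, K (G (y k)).
Hypothesis no_growth : forall k, ~ quad_growth f kappa (x k) (v k) (y k).

Definition multiplier_gap k : R := - dot (l k) (G (y k)) / t k ^ 2.

Let quotient_G k : vec p := fun i =>
  taylor2_quotient (fun z => G z i) (fun z => DG z i) x w t k.

Let lagrangian_quotient k : R :=
  taylor2_quotient f Df x w t k + dot (l k) (quotient_G k).

Lemma lim_lagrangian_quotient : is_lim_seq lagrangian_quotient
  (/ 2 * lagrangian_hess (D2f xbar) (D2G xbar) l0 w0).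
Proof.
rewrite /lagrangian_hess Rmult_plus_distr_l -dotZr; apply: is_lim_seq_plus'.
  exact: lim_taylor2_quotient.
exact: lim_dot lim_l (fun i => lim_taylor2_quotient (C2G i) lim_x lim_w t_gt0 lim_t).
Qed.

Let t2_gt0 k : 0 < t k ^ 2. Proof. exact: pow_lt. Qed.

Lemma lagrangian_quotient_gap k : t k ^ 2 * (lagrangian_quotient k + multiplier_gap k) =
  f (y k) - f (x k) - t k * dot (v k) (w k).
Proof.
have t2k := t2_gt0 k; have tk := t_gt0 k.
have grad_w : dot (v k) (w k) = dot (Df (x k)) (w k) + dot (l k) (jac_r (DG (x k)) (w k)).
  by rewrite -dot_adj -(KKT_grad (kkt k)) dotBl; ring.
have quotient_l : t k ^ 2 * dot (l k) (quotient_G k) =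
    dot (l k) (G (y k)) - t k * dot (l k) (jac_r (DG (x k)) (w k)).
  rewrite -dotZr (_ : vscale _ _ = vsub (vsub (G (y k)) (G (x k)))
    (vscale (t k) (jac_r (DG (x k)) (w k)))); last first.
    apply: functional_extensionality => i.
    by rewrite /y /quotient_G /taylor2_quotient /vscale /vsub /jac_r; field; lra.
  by rewrite !dotE (KKT_compl (kkt k)); ring.
rewrite /lagrangian_quotient !Rmult_plus_distr_l quotient_l grad_w.
by rewrite /multiplier_gap /taylor2_quotient -/(y k); field; lra.
Qed.

Lemma multiplier_gap_ge0 k : 0 <= multiplier_gap k.
Proof.
apply: Rmult_le_pos; last exact/Rlt_le/Rinv_0_lt_compat.
by have := KKT_polar (kkt k) (Ky k); lra.
Qed.

Lemma lagrangian_quotient_lt k : lagrangian_quotient k + multiplier_gap k < / (2 * kappa).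
Proof.
apply: (Rmult_lt_reg_l (t k ^ 2)) => //; rewrite lagrangian_quotient_gap.
have tk := t_gt0 k; have := Rnot_le_lt _ _ (@no_growth k).
by rewrite vaddK dotZr vnormZ_ge0 ?w1 /Rdiv; lra.
Qed.

Lemma multiplier_gap_bounded : exists B, forall k, multiplier_gap k <= B.
Proof.
have [M leM] := lim_bounded lim_lagrangian_quotient.
exists (/ (2 * kappa) + M) => k; have := lagrangian_quotient_lt k.
by have /Rabs_le_between := leM k; lra.
Qed.

Lemma growth_failure_curvature : lagrangian_hess (D2f xbar) (D2G xbar) l0 w0 <= / kappa.
Proof.
suff : / 2 * lagrangian_hess (D2f xbar) (D2G xbar) l0 w0 <= / (2 * kappa).
  by rewrite Rinv_mult; lra.
apply: lim_le lim_lagrangian_quotient (is_lim_seq_const _) => k.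
by have := lagrangian_quotient_lt k; have := multiplier_gap_ge0 k; lra.
Qed.

Lemma growth_failure_orthogonal : dot l0 (jac_r (DG xbar) w0) = 0.
Proof.
have [B leB] := multiplier_gap_bounded.
have lim_Bt : is_lim_seq (fun k => B * t k) 0.
  by rewrite -[X in Finite X](Rmult_0_r B); apply/is_lim_seq_mult'/lim_t/is_lim_seq_const.
have lim_jac := jac_quotient_vlim C2G lim_x lim_w t_gt0 lim_t.
apply: lim_unique (lim_dot lim_l lim_jac) _; apply: lim_of_dist lim_Bt _ => k.
have tk := t_gt0 k.
have -> : dot (l k) (vscale (/ t k) (vsub (G (y k)) (G (x k)))) - 0 =
    - (multiplier_gap k * t k).
  by rewrite /multiplier_gap !dotE (KKT_compl (kkt k)); field; lra.
have := multiplier_gap_ge0 k; have := leB k.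
by move=> *; rewrite Rabs_Ropp Rabs_pos_eq; nra.
Qed.

End GrowthFailure.

(** * The second-order cone *)

Definition vcons {A : Type} {m} (a : A) (x : 'I_m -> A) : 'I_m.+1 -> A :=
  fun i => oapp x a (unlift ord0 i).

Definition vtail {m} (q : vec m.+1) : vec m := fun j => q (lift ord0 j).

Definition soc {m} (q : vec m.+1) : Prop := vnorm (vtail q) <= q ord0.

Lemma vcons0 A m (a : A) (x : 'I_m -> A) : vcons a x ord0 = a.
Proof. by rewrite /vcons unlift_none. Qed.

Lemma vconsS A m (a : A) (x : 'I_m -> A) j : vcons a x (lift ord0 j) = x j.
Proof. by rewrite /vcons liftK. Qed.

Lemma vtail_cons m (a : R) (x : vec m) : vtail (vcons a x) = x.
Proof. by apply: functional_extensionality => j; rewrite /vtail vconsS. Qed.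

Lemma eq_vcons A m (a : A) (x : 'I_m -> A) q :
  q ord0 = a -> (forall j, q (lift ord0 j) = x j) -> q = vcons a x.
Proof.
move=> q0 qS; apply: functional_extensionality => i.
by case: (unliftP ord0 i) => [j ->|->]; rewrite ?vconsS ?vcons0.
Qed.

Lemma dot_recl m (x y : vec m.+1) :
  dot x y = x ord0 * y ord0 + dot (vtail x) (vtail y).
Proof. by rewrite /dot big_ord_recl. Qed.

Lemma vlim_tail m (s : nat -> vec m.+1) q : vlim s q ->
  vlim (fun k => vtail (s k)) (vtail q).
Proof. by move=> sq j; apply: sq. Qed.

Lemma soc_ge0 m (q : vec m.+1) : soc q -> 0 <= q ord0.
Proof. by rewrite /soc; have := vnorm_ge0 (vtail q); lra. Qed.

Lemma soc_gt0 m (q : vec m.+1) : soc q -> q <> @vzero m.+1 -> 0 < q ord0.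
Proof.
move=> Kq q_neq0; case: (soc_ge0 Kq) => // q00; case: q_neq0.
have tail0 : vtail q = @vzero m.
  by apply: vnorm_eq0; move: Kq; rewrite /soc -q00; have := vnorm_ge0 (vtail q); lra.
rewrite (eq_vcons (esym q00) (fun j => congr1 (fun z => z j) tail0)).
by apply/esym/eq_vcons.
Qed.

Lemma soc_convex_cone m : convex_cone (@soc m).
Proof.
split=> [|a q a_ge0|x y]; rewrite /soc.
- by rewrite (_ : vtail _ = @vzero m) // vnorm0 /vzero; lra.
- rewrite (_ : vtail (vscale a q) = vscale a (vtail q)) // vnormZ_ge0 // => Kq.
  exact: Rmult_le_compat_l.
- rewrite (_ : vtail (vadd x y) = vadd (vtail x) (vtail y)) //.
  by have := vnormD (vtail x) (vtail y); rewrite [vadd x y ord0]/vadd; lra.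
Qed.

Lemma soc_closed m : vclosed (@soc m).
Proof. by move=> s q sq Ks; apply: lim_le Ks (lim_vnorm (vlim_tail sq)) (sq ord0). Qed.

Lemma polar_soc m (l : vec m.+1) : polar soc l -> vnorm (vtail l) <= - l ord0.
Proof.
move=> pol; have [lr_gt0|lr0] := vnorm_ge0 (vtail l).
  have := pol (vcons (vnorm (vtail l)) (vtail l)).
  by rewrite /soc dot_recl vtail_cons vcons0 -vnorm_sqr => /(_ (Rle_refl _)); nra.
have := pol (vcons 1 (@vzero m)).
by rewrite /soc dot_recl vtail_cons vcons0 dot0r vnorm0 -lr0 => /(_ Rle_0_1); lra.
Qed.

(* It vanishes for a complementary pair [(l, z)], and the gap [- <l, z>] controls it
   quantitatively: this makes complementarity stable under limits. *)
Definition soc_defect {m} (l z : vec m.+1) : vec m :=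
  vsub (vscale (- l ord0) (vtail z)) (vscale (z ord0) (vtail l)).

Lemma soc_defect_le m (l z : vec m.+1) : polar soc l -> soc z ->
  vnorm (soc_defect l z) ^ 2 <= 2 * (- l ord0) * z ord0 * (- dot l z).
Proof.
move=> /polar_soc lr Kz; have z0 := soc_ge0 Kz; move: Kz; rewrite /soc => zr.
have nz := vnorm_ge0 (vtail z); have nl := vnorm_ge0 (vtail l).
rewrite vnorm_sqr !dotE (dotC (vtail z) (vtail l)) -!vnorm_sqr dot_recl.
set b := - l ord0 in lr *; have -> : l ord0 = - b by rewrite /b; ring.
have : (b * vnorm (vtail z)) ^ 2 <= (b * z ord0) ^ 2.
  by apply: pow_incr; split; [nra|apply: Rmult_le_compat_l; lra].
have : (z ord0 * vnorm (vtail l)) ^ 2 <= (z ord0 * b) ^ 2.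
  by apply: pow_incr; split; [nra|apply: Rmult_le_compat_l; lra].
by nra.
Qed.

Lemma soc_defect_eq0 m (l z : vec m.+1) : polar soc l -> soc z ->
  dot l z = 0 -> soc_defect l z = @vzero m.
Proof.
move=> pol Kz lz0; apply: vnorm_eq0.
by have := soc_defect_le pol Kz; have := vnorm_ge0 (soc_defect l z); rewrite lz0; nra.
Qed.

Lemma soc_defectB m (l z z' : vec m.+1) :
  soc_defect l (vsub z z') = vsub (soc_defect l z) (soc_defect l z').
Proof. by rewrite /soc_defect /vtail; vext. Qed.

Lemma soc_defectZ m a (l z : vec m.+1) :
  soc_defect l (vscale a z) = vscale a (soc_defect l z).
Proof. by rewrite /soc_defect /vtail; vext. Qed.

Lemma vlim_soc_defect m (l z : nat -> vec m.+1) l0 z0 : vlim l l0 -> vlim z z0 ->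
  vlim (fun k => soc_defect (l k) (z k)) (soc_defect l0 z0).
Proof.
move=> lim_l lim_z.
apply: vlimB (vlimZ _ (vlim_tail lim_z)) (vlimZ (lim_z ord0) (vlim_tail lim_l)).
exact: (is_lim_seq_opp _ _).1 (lim_l ord0).
Qed.

Lemma soc_defect_limit m (l y z : nat -> vec m.+1) (t : nat -> R) B l0 q :
  (forall k, 0 < t k) ->
  (forall k, polar soc (l k)) -> (forall k, soc (y k)) -> (forall k, soc (z k)) ->
  (forall k, dot (l k) (z k) = 0) -> (forall k, - dot (l k) (y k) / t k ^ 2 <= B) ->
  vlim l l0 -> vlim (fun k => vscale (/ t k) (vsub (y k) (z k))) q ->
  is_lim_seq (fun k => y k ord0) 0 -> soc_defect l0 q = @vzero m.
Proof.
move=> t_gt0 pol Ky Kz compl gapB lim_l lim_q y0.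
have lim_defect := vlim_soc_defect lim_l lim_q.
apply: vnorm_eq0; suff : vnorm (soc_defect l0 q) ^ 2 = 0.
  by have := vnorm_ge0 (soc_defect l0 q); nra.
have upper_lim : is_lim_seq (fun k => 2 * (- l k ord0) * y k ord0 * B) 0.
  rewrite -[X in Finite X](Rmult_0_l B) -[X in X * B](Rmult_0_r (2 * - l0 ord0)).
  do 2! [apply: is_lim_seq_mult' => //; try exact: is_lim_seq_const].
  apply: is_lim_seq_mult'; first exact: is_lim_seq_const.
  exact: (is_lim_seq_opp _ _).1 (lim_l ord0).
rewrite vnorm_sqr; apply: lim_unique (lim_dot lim_defect lim_defect) _.
apply: is_lim_seq_le_le (is_lim_seq_const 0) upper_lim => k.
split; first exact: dot_ge0.
have tk := t_gt0 k; have t2k := pow_lt _ 2 tk.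
rewrite soc_defectZ soc_defectB (soc_defect_eq0 (pol k) (Kz k) (compl k)) vsub0.
rewrite -vnorm_sqr vnormZ_ge0 ?Rpow_mult_distr; last exact/Rlt_le/Rinv_0_lt_compat.
have l0_ge0 : 0 <= - l k ord0.
  by have := polar_soc (pol k); have := vnorm_ge0 (vtail (l k)); lra.
apply: (@Rle_trans _ (2 * - l k ord0 * y k ord0 * (- dot (l k) (y k) / t k ^ 2))).
  rewrite pow_inv /Rdiv -Rmult_assoc (Rmult_comm (/ _)).
  apply: Rmult_le_compat_r (soc_defect_le (pol k) (Ky k)).
  exact/Rlt_le/Rinv_0_lt_compat.
by apply: Rmult_le_compat_l (gapB k); have := soc_ge0 (Ky k); nra.
Qed.

Definition soc_critical {m} (l q : vec m.+1) : Prop :=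
  dot l q = 0 /\ l ord0 * (vnorm (vtail q) ^ 2 - q ord0 ^ 2) = 0.

Lemma soc_critical_of_defect m (l q : vec m.+1) :
  dot l q = 0 -> soc_defect l q = @vzero m -> soc_critical l q.
Proof.
move=> lq0 defect0; split=> //.
have : dot (soc_defect l q) (vtail q) = 0 by rewrite defect0 dot0l.
have : q ord0 * (l ord0 * q ord0 + dot (vtail l) (vtail q)) = 0.
  by rewrite -dot_recl lq0; ring.
by rewrite !dotE vnorm_sqr; lra.
Qed.

(** * Uniform quadratic growth *)

Section UniformGrowth.

Variables (n m : nat) (f : vec n -> R) (Df : vec n -> vec n) (D2f : vec n -> mat n).
Variables (G : vec n -> vec m.+1) (DG : vec n -> 'I_m.+1 -> vec n).
Variables (D2G : vec n -> 'I_m.+1 -> mat n) (xbar : vec n) (s kappa : R).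
Variable lbar : vec m.+1.
Hypothesis C2f : C2_with f Df D2f xbar.
Hypothesis C2G : C2_map G DG D2G xbar.
Hypothesis G0 : G xbar ord0 = 0.
Hypothesis s_ge0 : 0 <= s.
Hypothesis lbar_unique : forall l, KKT soc Df G DG s xbar (@vzero n) l -> l = lbar.
Hypothesis second_order : forall u, vnorm u = 1 ->
  soc_critical lbar (jac_r (DG xbar) u) ->
  / kappa < lagrangian_hess (D2f xbar) (D2G xbar) lbar u.

Lemma growth_failure_direction (x v w : nat -> vec n) (t : nat -> R)
    (l : nat -> vec m.+1) w0 l0 :
  vlim x xbar -> vlim w w0 -> vlim l l0 -> (forall k, 0 < t k) -> is_lim_seq t 0 ->
  (forall k, vnorm (w k) = 1) -> (forall k, KKT soc Df G DG s (x k) (v k) (l k)) ->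
  (forall k, soc (G (vadd (x k) (vscale (t k) (w k))))) ->
  (forall k, ~ quad_growth f kappa (x k) (v k) (vadd (x k) (vscale (t k) (w k)))) ->
  soc_critical l0 (jac_r (DG xbar) w0) /\
  lagrangian_hess (D2f xbar) (D2G xbar) l0 w0 <= / kappa.
Proof.
move=> lim_x lim_w lim_l t_gt0 lim_t w1 kkt Ky fail.
have curv := growth_failure_curvature C2f C2G lim_x lim_w lim_l t_gt0 lim_t w1 kkt Ky fail.
have orth := growth_failure_orthogonal C2f C2G lim_x lim_w lim_l t_gt0 lim_t w1 kkt Ky fail.
split=> //; apply: soc_critical_of_defect orth _.
have [B gapB] := multiplier_gap_bounded C2f C2G lim_x lim_w lim_l t_gt0 lim_t w1 kkt fail.
have lim_jac := jac_quotient_vlim C2G lim_x lim_w t_gt0 lim_t.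
apply: (soc_defect_limit t_gt0 _ Ky _ _ gapB lim_l lim_jac).
- by move=> k; apply: KKT_polar (kkt k).
- by move=> k; apply: KKT_feasible (kkt k).
- by move=> k; apply: KKT_compl (kkt k).
- have lim_G := C2_map_vlim C2G (vlim_shift lim_x lim_w lim_t).
  by rewrite -G0; apply: lim_G.
Qed.

Lemma growth_failure_absurd (x y v : nat -> vec n) (l : nat -> vec m.+1) :
  vlim x xbar -> vlim y xbar -> vlim v (@vzero n) ->
  (forall k, KKT soc Df G DG s (x k) (v k) (l k)) -> (forall k, soc (G (y k))) ->
  ~ forall k, ~ quad_growth f kappa (x k) (v k) (y k).
Proof.
move=> lim_x lim_y lim_v kkt Ky fail.
pose t k := vnorm (vsub (y k) (x k)); pose w k := vscale (/ t k) (vsub (y k) (x k)).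
have t_gt0 k : 0 < t k.
  apply: vnorm_gt0 => /vsub_eq0 yx; apply: (fail k).
  by rewrite /quad_growth yx vdist0 dotBr /Rdiv; lra.
have w1 k : vnorm (w k) = 1.
  rewrite vnormZ_ge0; last exact/Rlt_le/Rinv_0_lt_compat.
  by rewrite Rinv_l //; have := t_gt0 k; rewrite /t; lra.
have tw k : vscale (t k) (w k) = vsub (y k) (x k).
  have tk := t_gt0 k; apply: functional_extensionality => i.
  by rewrite /w /vscale; field; lra.
have lim_t : is_lim_seq t 0 by rewrite -(vdist0 xbar); apply/lim_vnorm/vlimB.
have [phi [l0 [ephi lim_l kkt0]]] :=
  KKT_subseq_limit C2G s_ge0 C2f (@soc_closed m) lim_x lim_v kkt.
have [k|psi [w0 [epsi lim_w]]] := @bounded_seq_vsubseq _ (fun k => w (phi k)) 1.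
  by rewrite w1; lra.
have e := extraction_comp ephi epsi.
have w01 : vnorm w0 = 1.
  apply: lim_unique (lim_vnorm lim_w) _.
  by apply: is_lim_seq_ext (is_lim_seq_const 1) => k.
have [|||crit curv] := growth_failure_direction (t := fun k => t (phi (psi k)))
  (vlim_subseq e lim_x) lim_w (vlim_subseq epsi lim_l) _ (is_lim_seq_subseq _ _ _ e lim_t)
  (fun k => w1 _) (fun k => kkt (phi (psi k))).
- by [].
- by move=> k; rewrite tw vaddBK.
- by move=> k; rewrite tw vaddBK; apply: fail.
by move: crit curv; rewrite (lbar_unique kkt0) => /(second_order w01); lra.
Qed.

Lemma uniform_growth : exists r, 0 < r /\ forall x y v l,
  vnorm (vsub x xbar) < r -> vnorm (vsub y xbar) < r -> vnorm v < r ->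
  KKT soc Df G DG s x v l -> soc (G y) -> quad_growth f kappa x v y.
Proof.
apply: NNPP => no_r; pose fails r x y v l := [/\ vnorm (vsub x xbar) <= r,
  vnorm (vsub y xbar) <= r, vnorm (vsub v (@vzero n)) <= r,
  KKT soc Df G DG s x v l /\ soc (G y) & ~ quad_growth f kappa x v y].
have fail k : exists q : vec n * vec n * vec n * vec m.+1,
    fails (inv_succ k) q.1.1.1 q.1.1.2 q.1.2 q.2.
  apply: NNPP => no_q; apply: no_r; exists (inv_succ k).
  split=> [|x y v l x_r y_r v_r kkt Ky]; first exact: inv_succ_gt0.
  apply: NNPP => no_growth; apply: no_q; exists (x, y, v, l).
  by rewrite /fails vsub0; split=> //; apply: Rlt_le.
have [q Hq] := choice _ fail.
apply: (@growth_failure_absurd (fun k => (q k).1.1.1) (fun k => (q k).1.1.2)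
  (fun k => (q k).1.2) (fun k => (q k).2)).
- by apply: vlim_of_dist lim_inv_succ _ => k; case: (Hq k).
- by apply: vlim_of_dist lim_inv_succ _ => k; case: (Hq k).
- by apply: vlim_of_dist lim_inv_succ _ => k; case: (Hq k).
- by move=> k; case: (Hq k) => _ _ _ [].
- by move=> k; case: (Hq k) => _ _ _ [].
- by move=> k; case: (Hq k).
Qed.

End UniformGrowth.

(** * Tilt stability from quadratic growth *)

Lemma argmin_reg_normal n (f : vec n -> R) (C : vec n -> Prop) xbar gamma v x G :
  argminM f C xbar gamma v x -> vnorm (vsub x xbar) < gamma -> has_grad f x G ->
  reg_normal C x (vsub v G).
Proof.
move=> [Cx [_ x_min]] x_lt gf; split=> // eps eps_gt0.
have [r [r_gt0 Hr]] := vnear_and (vnear_ball x_lt) (has_grad_near gf eps_gt0).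
exists r; split=> // y Cy /Hr[y_lt /Rabs_le_between].
by have := x_min y Cy (Rlt_le _ _ y_lt); rewrite !dotE; lra.
Qed.

Lemma le_of_sqr_div_le a b c : 0 < c -> 0 <= b -> a ^ 2 / c <= b * a -> a <= c * b.
Proof.
move=> c_gt0 b_ge0 /(Rle_div_l _ _ _ c_gt0) le_a2; apply: Rnot_lt_le => lt_a.
have : 0 <= c * b by nra.
by nra.
Qed.

Lemma quad_growth0_le n (f : vec n -> R) kappa x y : 0 < kappa ->
  quad_growth f kappa x (@vzero n) y -> f x <= f y.
Proof.
move=> kappa_gt0; rewrite /quad_growth dot0l.
have : 0 <= vnorm (vsub y x) ^ 2 / (2 * kappa).
  by apply: Rdiv_le_0_compat; [exact: pow2_ge_0|lra].
by lra.
Qed.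

Section Argmin.

Variables (n : nat) (f : vec n -> R) (C : vec n -> Prop) (xbar : vec n) (gamma : R).
Hypothesis Cxbar : C xbar.
Hypothesis gamma_ge0 : 0 <= gamma.

Lemma argminM_exists v :
  vclosed (fun x => C x /\ vnorm (vsub x xbar) <= gamma) ->
  vcontinuous_on (fun x => C x /\ vnorm (vsub x xbar) <= gamma) f ->
  exists x, argminM f C xbar gamma v x.
Proof.
set B := fun x => _ => clB contf.
have cptB : vcompact B.
  apply: closed_bounded_compact (vnorm xbar + gamma) clB _ => x [_ x_le].
  by have := vnormD xbar (vsub x xbar); rewrite vaddBK; lra.
have [||x [[Cx x_le] x_min]] :=
    compact_min (F := fun x => f x - dot v x) (x0 := xbar) cptB.
- move=> s x sx Bs Bx; apply: is_lim_seq_minus'; first exact: contf.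
  exact: lim_dot (vlim_const v) sx.
- by rewrite /B vdist0.
by exists x; split=> //; split=> // y Cy y_le; apply: x_min.
Qed.

Lemma argminM_dist_le kappa v x : 0 < kappa ->
  (forall y, C y -> vnorm (vsub y xbar) <= gamma ->
     quad_growth f kappa xbar (@vzero n) y) ->
  argminM f C xbar gamma v x -> vnorm (vsub x xbar) <= 2 * kappa * vnorm v.
Proof.
move=> kappa_gt0 growth [Cx [x_le x_min]].
apply: le_of_sqr_div_le; [lra|exact: vnorm_ge0|].
have := x_min xbar Cxbar; rewrite vdist0 => /(_ gamma_ge0).
have := growth x Cx x_le; rewrite /quad_growth dot0l.
by have := dot_le_vnorm v (vsub x xbar); rewrite dotBr; lra.
Qed.

End Argmin.

(* Adding the two growth inequalities gives
   [|x1 - x2|^2 / kappa <= <v1 - v2, x1 - x2>]. *)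
Lemma lipschitz_of_growth n (f : vec n -> R) kappa x1 x2 v1 v2 : 0 < kappa ->
  quad_growth f kappa x1 v1 x2 -> quad_growth f kappa x2 v2 x1 ->
  vnorm (vsub x1 x2) <= kappa * vnorm (vsub v1 v2).
Proof.
move=> kappa_gt0; rewrite /quad_growth (vdistC x2 x1) => growth1 growth2.
apply: le_of_sqr_div_le => //; first exact: vnorm_ge0.
apply: Rle_trans (dot_le_vnorm _ _).
have -> : vnorm (vsub x1 x2) ^ 2 / kappa =
  vnorm (vsub x1 x2) ^ 2 / (2 * kappa) + vnorm (vsub x1 x2) ^ 2 / (2 * kappa).
  by field; lra.
by move: growth1 growth2; rewrite !dotE; lra.
Qed.

Lemma tilt_stable_of_argmin n (f : vec n -> R) (C : vec n -> Prop)
    xbar kappa gamma delta :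
  0 < kappa -> 0 < gamma -> 0 < delta -> argminM f C xbar gamma (@vzero n) xbar ->
  (forall v, exists x, argminM f C xbar gamma v x) ->
  (forall v1 v2 x1 x2, vnorm v1 < delta -> vnorm v2 < delta ->
     argminM f C xbar gamma v1 x1 -> argminM f C xbar gamma v2 x2 ->
     vnorm (vsub x1 x2) <= kappa * vnorm (vsub v1 v2)) ->
  tilt_stable f C xbar kappa.
Proof.
move=> kappa_gt0 gamma_gt0 delta_gt0 M0 exM lip.
have uniq v x x' : vnorm v < delta -> argminM f C xbar gamma v x ->
    argminM f C xbar gamma v x' -> x' = x.
  move=> v_lt M1 M2; have := lip _ _ _ _ v_lt v_lt M2 M1.
  rewrite vdist0 Rmult_0_r => dist_le0; apply/vsub_eq0/vnorm_eq0.
  by have := vnorm_ge0 (vsub x' x); lra.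
split=> //; exists gamma; split=> //; split=> [|x].
  exists delta; split=> //; split=> // v v_lt.
  by have [x Mx] := exM v; exists x; split=> // x'; apply: uniq v_lt Mx.
by split=> [Mx|-> //]; apply: uniq _ M0 Mx; rewrite vnorm0.
Qed.

Lemma tilt_stable_of_growth n (f : vec n -> R) Df (C : vec n -> Prop) xbar kappa r :
  0 < kappa -> 0 < r -> C xbar ->
  (forall x, vnorm (vsub x xbar) < r -> has_grad f x (Df x)) ->
  (forall s x, vlim s x -> (forall k, C (s k)) -> vnorm (vsub x xbar) < r -> C x) ->
  (forall y, vnorm (vsub y xbar) < r -> C y -> quad_growth f kappa xbar (@vzero n) y) ->
  (forall x y v, vnorm (vsub x xbar) < r -> vnorm (vsub y xbar) < r -> vnorm v < r ->
     reg_normal C x (vsub v (Df x)) -> C y -> quad_growth f kappa x v y) ->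
  tilt_stable f C xbar kappa.
Proof.
move=> kappa_gt0 r_gt0 Cxbar gf clC growth0 growth.
pose gamma := r / 2; have gamma_gt0 : 0 < gamma by rewrite /gamma; lra.
have gamma_lt : gamma < r by rewrite /gamma; lra.
have k2_ge0 : 0 <= 2 * kappa by lra.
have [delta [delta_gt0 delta_le deltak]] := small_factor_exists gamma_gt0 k2_ge0 r_gt0.
have growth0_ball y : C y -> vnorm (vsub y xbar) <= gamma ->
    quad_growth f kappa xbar (@vzero n) y.
  by move=> Cy y_le; apply: growth0 => //; lra.
have near_xbar v x : vnorm v < delta -> argminM f C xbar gamma v x ->
    vnorm (vsub x xbar) < gamma.
  move=> v_lt Mx.
  have := argminM_dist_le Cxbar (Rlt_le _ _ gamma_gt0) kappa_gt0 growth0_ball Mx.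
  by have := vnorm_ge0 v; nra.
have lip v1 v2 x1 x2 : vnorm v1 < delta -> vnorm v2 < delta ->
    argminM f C xbar gamma v1 x1 -> argminM f C xbar gamma v2 x2 ->
    vnorm (vsub x1 x2) <= kappa * vnorm (vsub v1 v2).
  move=> v1_lt v2_lt M1 M2.
  have x1_lt := near_xbar _ _ v1_lt M1; have x2_lt := near_xbar _ _ v2_lt M2.
  have N1 := argmin_reg_normal M1 x1_lt (gf x1 ltac:(lra)).
  have N2 := argmin_reg_normal M2 x2_lt (gf x2 ltac:(lra)).
  apply: (lipschitz_of_growth kappa_gt0).
    by apply: growth N1 M2.1; lra.
  by apply: growth N2 M1.1; lra.
apply: (tilt_stable_of_argmin kappa_gt0 gamma_gt0 delta_gt0 _ _ lip) => [|v].
  split=> //; split=> [|y Cy y_le]; first by rewrite vdist0; lra.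
  by have := quad_growth0_le kappa_gt0 (growth0_ball y Cy y_le); rewrite !dot0l; lra.
apply: (argminM_exists Cxbar (Rlt_le _ _ gamma_gt0)) => [s x sx Bs|s x sx _ [_ x_le]].
  have x_le : vnorm (vsub x xbar) <= gamma.
    by apply: vclosed_ball sx _ => k; case: (Bs k).
  by split=> //; apply: clC sx _ _ => [k|]; [case: (Bs k)|lra].
by apply: has_grad_lim sx; apply: gf; lra.
Qed.

Lemma tilt_le_of_tilt_stable n (f : vec n -> R) (C : vec n -> Prop) xbar b : 0 <= b ->
  (forall kappa, b < kappa -> tilt_stable f C xbar kappa) -> tilt_le f C xbar b.
Proof.
move=> b_ge0 stable eps eps_gt0.
have [|_ [gamma [gamma_gt0 [[delta [delta_gt0 lip]] _]]]] := stable (b + eps / 2).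
  by lra.
by exists gamma, (b + eps / 2), delta; do ![split=> //]; lra.
Qed.

(** * The special multiplier *)

Definition soc_hat {m} (q : vec m.+1) : vec m.+1 := vcons (- q ord0) (vtail q).

Definition special_multiplier {n m} (d : vec n) (A : 'I_m.+1 -> vec n) (u : vec n) :
    vec m.+1 :=
  let qhat := soc_hat (jac_r A u) in vscale (vnorm d / vnorm (adj A qhat)) qhat.

Lemma soc_complementary_ray m (l q : vec m.+1) :
  polar soc l -> soc q -> q <> @vzero m.+1 -> dot l q = 0 ->
  exists a, 0 <= a /\ l = vscale a (soc_hat q).
Proof.
move=> pol Kq q_neq0 lq; have q0_gt0 := soc_gt0 Kq q_neq0.
have defect0 := soc_defect_eq0 pol Kq lq.
exists (- l ord0 / q ord0); split.
  apply: Rdiv_le_0_compat => //.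
  by have := polar_soc pol; have := vnorm_ge0 (vtail l); lra.
apply: functional_extensionality => i; rewrite /soc_hat /vscale.
case: (unliftP ord0 i) => [j ->|->]; rewrite ?vconsS ?vcons0; last by field; lra.
have := congr1 (fun z => z j) defect0; rewrite /soc_defect /vsub /vscale /vtail /vzero.
by move=> par_j; apply: (Rmult_eq_reg_l (q ord0)); [field_simplify|]; lra.
Qed.

Section SpecialMultiplier.

Variables (n m : nat) (f : vec n -> R) (Df : vec n -> vec n) (D2f : vec n -> mat n).
Variables (G : vec n -> vec m.+1) (DG : vec n -> 'I_m.+1 -> vec n).
Variables (D2G : vec n -> 'I_m.+1 -> mat n) (xbar ubar : vec n) (s : R).
Hypothesis C2f : C2_with f Df D2f xbar.
Hypothesis C2G : C2_map G DG D2G xbar.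
Hypothesis Gxbar : G xbar = @vzero m.+1.
Hypothesis s_ge0 : 0 <= s.
Hypothesis errb : error_bound soc G s xbar.
Hypothesis stationary : lim_normal (fun x => soc (G x)) xbar (vopp (Df xbar)).
Hypothesis tangent_u : tangent (fun x => soc (G x)) xbar ubar.
Hypothesis critical_u : dot (Df xbar) ubar = 0.
Hypothesis jac_u_neq0 : jac_r (DG xbar) ubar <> @vzero m.+1.

Lemma tangent_jac_soc : soc (jac_r (DG xbar) ubar).
Proof.
have [t [u [t_gt0 [/is_lim_seq_Reals lim_t [/seq_cv_vlim lim_u Ku]]]]] := tangent_u.
have lim_q := jac_quotient_vlim C2G (vlim_const xbar) lim_u t_gt0 lim_t.
have [_ KZ _] := @soc_convex_cone m.
apply: soc_closed lim_q _ => k; rewrite Gxbar vsub0.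
by apply: KZ (Ku k); apply/Rlt_le/Rinv_0_lt_compat.
Qed.

(* Complementarity with the critical direction [ubar] puts every multiplier on one ray;
   the gradient equation then determines its norm, or, when [Df xbar = 0], the bound
   on the multiplier does (the coefficient may then read [0 / 0], which is [0]). *)
Lemma KKT_special_multiplier l : KKT soc Df G DG s xbar (@vzero n) l ->
  l = special_multiplier (Df xbar) (DG xbar) ubar.
Proof.
move=> kkt; rewrite /special_multiplier; set q := jac_r _ _.
have grad : vopp (Df xbar) = adj (DG xbar) l.
  by rewrite -(KKT_grad kkt); vext.
have lq : dot l q = 0 by rewrite /q -dot_adj -grad dotNl critical_u; ring.
have [a [a_ge0 l_eq]] :=
  soc_complementary_ray (KKT_polar kkt) tangent_jac_soc jac_u_neq0 lq.
have norm_Df : vnorm (Df xbar) = a * vnorm (adj (DG xbar) (soc_hat q)).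
  by rewrite -(vnormN (Df xbar)) grad {1}l_eq adjZ vnormZ_ge0.
have [Df0|Df_neq0] := Req_dec (vnorm (Df xbar)) 0.
  have -> : l = @vzero m.+1.
    have := KKT_bound kkt; rewrite (_ : vsub _ _ = vopp (Df xbar)); last by vext.
    by rewrite vnormN Df0 => ?; apply: vnorm_eq0; have := vnorm_ge0 l; lra.
  by rewrite Df0 /Rdiv Rmult_0_l; vext.
rewrite {1}l_eq norm_Df; congr vscale; field => adj0.
by apply: Df_neq0; rewrite norm_Df adj0 Rmult_0_r.
Qed.

Lemma tilt_stable_special_multiplier kappa : 0 < kappa ->
  let lbar := special_multiplier (Df xbar) (DG xbar) ubar in
  (forall u, vnorm u = 1 -> soc_critical lbar (jac_r (DG xbar) u) ->
     / kappa < lagrangian_hess (D2f xbar) (D2G xbar) lbar u) ->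
  tilt_stable f (fun x => soc (G x)) xbar kappa.
Proof.
move=> kappa_gt0 lbar second_order.
have G0 : G xbar ord0 = 0 by rewrite Gxbar.
have cK := @soc_convex_cone m; have clK := @soc_closed m.
have [l kkt] := KKT_of_lim_normal C2G s_ge0 C2f clK cK errb stationary.
have [r1 [r1_gt0 growth]] :=
  uniform_growth C2f C2G G0 s_ge0 KKT_special_multiplier second_order.
have [r2 [r2_gt0 near_xbar]] := vnear_and (KKT_of_reg_normal Df C2G s_ge0 cK errb)
  (vnear_and (C2_has_grad C2f) (C2_map_has_grad C2G)).
have r_gt0 : 0 < Rmin r1 r2 by exact: Rmin_pos.
have := Rmin_l r1 r2; have := Rmin_r r1 r2 => r_le2 r_le1.
apply: (tilt_stable_of_growth (Df := Df) kappa_gt0 r_gt0).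
- exact: KKT_feasible kkt.
- by move=> x x_r; have [|_ []] := near_xbar x; first lra.
- move=> y x yx Ky x_r; have [|_ [_ gG]] := near_xbar x; first lra.
  by apply: clK _ Ky => i; apply: has_grad_lim (gG i) yx.
- by move=> y y_r Ky; apply: growth kkt Ky; rewrite ?vdist0 ?vnorm0; lra.
- move=> x y v x_r y_r v_r nv Ky; have [|mult _] := near_xbar x; first lra.
  by have [l' kkt'] := mult v nv; apply: growth kkt' Ky; lra.
Qed.

Lemma tilt_le_special_multiplier kappa b : 0 < kappa -> 0 <= b ->
  let lbar := special_multiplier (Df xbar) (DG xbar) ubar in
  let hess u := lagrangian_hess (D2f xbar) (D2G xbar) lbar u in
  let critical u := vnorm u = 1 /\ soc_critical lbar (jac_r (DG xbar) u) in
  (forall u, critical u -> / kappa < hess u) -> (forall u, critical u -> / hess u <= b) ->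
  tilt_le f (fun x => soc (G x)) xbar b.
Proof.
move=> kappa_gt0 b_ge0 lbar hess critical second_order hess_le.
apply: (tilt_le_of_tilt_stable b_ge0) => k lt_bk.
apply: tilt_stable_special_multiplier => [|u u1 crit_u]; first lra.
have hess_gt0 : 0 < hess u.
  apply: Rlt_trans (second_order u (conj u1 crit_u)).
  exact: Rinv_0_lt_compat.
rewrite -(Rinv_inv (lagrangian_hess _ _ _ _)); apply: Rinv_0_lt_contravar.
  exact: Rinv_0_lt_compat.
by apply: Rle_lt_trans lt_bk; apply: hess_le.
Qed.

End SpecialMultiplier.

(** * The problem in split form [g = (g0, gr)] *)

Lemma in_Gamma_soc n m (g0 : vec n -> R) (gr : vec n -> vec m) :
  in_Gamma g0 gr = (fun x => soc (vcons (g0 x) (gr x))).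
Proof.
apply: functional_extensionality => x.
by rewrite /in_Gamma /in_Q /soc vtail_cons vcons0.
Qed.

Lemma is_inf_exists (E : R -> Prop) b t0 : (forall t, E t -> b <= t) -> E t0 ->
  exists a, is_inf E a.
Proof.
move=> Eb Et0; have [lbE glbE] := Glb_Rbar_correct E.
have : Rbar_le b (Glb_Rbar E) by apply: glbE => t /Eb.
have /= := lbE t0 Et0.
case: (Glb_Rbar E) lbE glbE => // a lbE glbE _ _; exists a.
by split=> [t /lbE //|c Ec]; apply: (glbE c) => t /Ec.
Qed.

Lemma is_inf_lt (E : R -> Prop) a b : is_inf E a -> a < b -> exists t, E t /\ t < b.
Proof.
move=> [_ glbE] lt_ab; apply: NNPP => no_t.
suff : b <= a by lra.
by apply: glbE => t Et; apply: Rnot_lt_le => lt_t; apply: no_t; exists t.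
Qed.

Lemma vdist_vcons m a (x : vec m) (q : vec m.+1) : vnorm (vsub (vcons a x) q) =
  sqrt ((a - q ord0) ^ 2 + vnorm (vsub x (vtail q)) ^ 2).
Proof.
rewrite (_ : vsub _ q = vcons (a - q ord0) (vsub x (vtail q))).
  by rewrite {1}/vnorm dot_recl vcons0 vtail_cons -vnorm_sqr; congr sqrt; ring.
by apply: eq_vcons => [|j]; rewrite /vsub ?vcons0 ?vconsS.
Qed.

(* The factor [2] leaves room for the infimum in the distance to [Gamma] not to be
   attained. *)
Lemma error_bound_MSCQ n m (g0 : vec n -> R) (gr : vec n -> vec m) xbar sigma :
  in_Gamma g0 gr xbar -> MSCQ g0 gr xbar sigma ->
  error_bound soc (fun x => vcons (g0 x) (gr x)) (2 * sigma) xbar.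
Proof.
move=> Gx [sigma_gt0 [r [r_gt0 Hr]]]; exists r; split=> // y y_r q Kq.
have [dist_gt0|/esym/vnorm_eq0/vsub_eq0 gy_q] :=
    vnorm_ge0 (vsub (vcons (g0 y) (gr y)) q); last first.
  by exists y; rewrite gy_q !vdist0; split=> //; lra.
have [||d1 inf1] := @is_inf_exists
    (fun t => exists z, in_Gamma g0 gr z /\ t = vnorm (vsub y z)) 0 (vnorm (vsub y xbar)).
- by move=> t [z [_ ->]]; apply: vnorm_ge0.
- by exists xbar.
pose E t := exists q0 (qr : vec m), in_Q q0 qr /\
  t = sqrt ((g0 y - q0) ^ 2 + vnorm (vsub (gr y) qr) ^ 2).
have E_dist : E (vnorm (vsub (vcons (g0 y) (gr y)) q)).
  by exists (q ord0), (vtail q); split=> //; apply: vdist_vcons.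
have [|d2 inf2] := is_inf_exists (b := 0) _ E_dist.
  by move=> t [q0 [qr [_ ->]]]; apply: sqrt_pos.
have d12 := Hr y y_r d1 d2 inf1 inf2; have d2_le := inf2.1 _ E_dist.
have [|_ [[z [Gz ->]] /Rlt_le dist_z]] :=
    is_inf_lt (b := 2 * sigma * vnorm (vsub (vcons (g0 y) (gr y)) q)) inf1.
  by nra.
by exists z; rewrite in_Gamma_soc in Gz.
Qed.

Lemma jac_vcons n m (a : vec n) (A : 'I_m -> vec n) u :
  jac_r (vcons a A) u = vcons (dot a u) (jac_r A u).
Proof. by apply: eq_vcons => [|j]; rewrite /jac_r ?vcons0 ?vconsS. Qed.

Lemma vcons_eq0 m a (x : vec m) : vcons a x = @vzero m.+1 -> a = 0 /\ forall i, x i = 0.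
Proof.
move=> ax0; split=> [|i]; first by rewrite -(vcons0 a x) ax0.
by rewrite -(vconsS a x i) ax0.
Qed.

Lemma C2_map_vcons n m (a : vec n -> R) Da D2a (F : vec n -> vec m) DF D2F x0 :
  C2_with a Da D2a x0 -> C2_map F DF D2F x0 ->
  C2_map (fun x => vcons (a x) (F x)) (fun x => vcons (Da x) (DF x))
    (fun x => vcons (D2a x) (D2F x)) x0.
Proof.
by move=> C2a C2F i; rewrite /vcons; case: (unlift ord0 i) => [j|]; [apply: C2F|].
Qed.

Lemma special_multiplier_vcons n m (d a : vec n) (A : 'I_m -> vec n) u :
  special_multiplier d (vcons a A) u = vcons (lam0 d a A u) (lamr d a A u).
Proof.
have gstar_adj : gstar_ghat a A u = adj (vcons a A) (soc_hat (jac_r (vcons a A) u)).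
  apply: functional_extensionality => j.
  rewrite /gstar_ghat /adj big_ord_recl /soc_hat jac_vcons !vtail_cons !vcons0.
  by congr (_ + _); apply: eq_bigr => i _; rewrite !vconsS.
rewrite /special_multiplier -gstar_adj /soc_hat jac_vcons vcons0 vtail_cons.
by apply: eq_vcons => [|j]; rewrite /vscale ?vcons0 ?vconsS.
Qed.

Lemma lagrangian_hess_vcons n m (A B : mat n) (D : 'I_m -> mat n) l0 (lr : vec m) u :
  lagrangian_hess A (vcons B D) (vcons l0 lr) u =
  quad (fun i j => A i j + l0 * B i j + \big[Rplus/0]_(k < m) (lr k * D k i j)) u.
Proof.
rewrite !quadD quad_scale (quad_sum (fun k i j => lr k * D k i j)).
rewrite /lagrangian_hess dot_recl !vcons0 Rplus_assoc vtail_cons; congr (_ + (_ + _)).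
by apply: eq_bigr => k _; rewrite quad_scale /vtail vconsS.
Qed.

Theorem theorem4p3 (n m : nat)
  (f : vec n -> R) (Df : vec n -> vec n) (D2f : vec n -> mat n)
  (g0 : vec n -> R) (Dg0 : vec n -> vec n) (D2g0 : vec n -> mat n)
  (gr : vec n -> vec m) (Dgr : vec n -> 'I_m -> vec n) (D2gr : vec n -> 'I_m -> mat n)
  (xbar ubar : vec n) (sigma kappa : R) :
  (0 < n)%N -> (0 < m)%N ->
  C2_with f Df D2f xbar ->
  C2_with g0 Dg0 D2g0 xbar ->
  (forall i, C2_with (fun x => gr x i) (fun x => Dgr x i) (fun x => D2gr x i) xbar) ->
  g0 xbar = 0 -> (forall i, gr xbar i = 0) ->
  (* stationarity: - grad f(xbar) in the limiting normal cone to Gamma *)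
  lim_normal (in_Gamma g0 gr) xbar (vopp (Df xbar)) ->
  MSCQ g0 gr xbar sigma ->
  critical_cone (in_Gamma g0 gr) xbar (vopp (Df xbar)) ubar ->
  ~ (dot (Dg0 xbar) ubar = 0 /\ forall i, dot (Dgr xbar i) ubar = 0) ->
  0 < kappa ->
  let l0 := lam0 (Df xbar) (Dg0 xbar) (Dgr xbar) ubar in
  let lr := lamr (Df xbar) (Dg0 xbar) (Dgr xbar) ubar in
  let H : mat n := fun i j => D2f xbar i j + l0 * D2g0 xbar i j
                     + \big[Rplus/0]_(k < m) (lr k * D2gr xbar k i j) in
  let adm (u : vec n) : Prop :=
      vnorm u = 1 /\
      l0 * dot (Dg0 xbar) u + dot lr (jac_r (Dgr xbar) u) = 0 /\
      l0 * ((vnorm (jac_r (Dgr xbar) u)) ^ 2 - (dot (Dg0 xbar) u) ^ 2) = 0 in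
  (forall u, adm u -> 1 / kappa < quad H u) ->
  tilt_stable f (in_Gamma g0 gr) xbar kappa /\
  (forall b, 0 <= b -> (forall u, adm u -> 1 / quad H u <= b) ->
     tilt_le f (in_Gamma g0 gr) xbar b).
Proof.
move=> _ _ C2f C2g0 C2gr g00 gr0 stat mscq [tan_u crit_u] jac_u kappa_gt0.
move=> l0 lr H adm sosc.
pose G x := vcons (g0 x) (gr x); pose DG x := vcons (Dg0 x) (Dgr x).
have C2G := C2_map_vcons C2g0 C2gr.
have Gxbar : G xbar = @vzero m.+1 by apply/esym/eq_vcons.
have errb := error_bound_MSCQ stat.1 mscq.
have s_ge0 : 0 <= 2 * sigma by case: mscq; lra.
have Du : dot (Df xbar) ubar = 0 by move: crit_u; rewrite dotNl; lra.
have q_neq0 : jac_r (DG xbar) ubar <> @vzero m.+1.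
  by rewrite jac_vcons => /vcons_eq0.
have adm_critical u :
    vnorm u = 1 -> soc_critical (vcons l0 lr) (jac_r (DG xbar) u) -> adm u.
  by move=> u1; rewrite /soc_critical jac_vcons dot_recl !vtail_cons !vcons0 => -[].
rewrite in_Gamma_soc in stat tan_u *; split=> [|b b_ge0 quad_le].
  apply: (tilt_stable_special_multiplier C2f C2G Gxbar s_ge0 errb stat tan_u) => // u u1.
  rewrite special_multiplier_vcons lagrangian_hess_vcons -Rdiv_1_l.
  by move=> /(adm_critical u u1); apply: sosc.
apply: (tilt_le_special_multiplier C2f C2G Gxbar s_ge0 errb stat tan_u _ _ kappa_gt0
  b_ge0) => //; rewrite special_multiplier_vcons => u [u1 /(adm_critical u u1)];
  rewrite lagrangian_hess_vcons -Rdiv_1_l; [exact: sosc|exact: quad_le].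
Qed.
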